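(* Let $\mathbb{K}$ be an algebraically closed field. (i) For every positive integer $N\geqslant 1$ and all integers $c,r\geqslant 0$ with $2c+r\geqslant N$, there holds the codimension estimate $$\operatorname{codim}\mathscr{M}_{2c+r}^{N}\ \geqslant\ \dim\overset{\circ}{\mathbb{P}}(\mathrm{T}_{\mathbb{P}^N})=2N-1 .$$ (ii) For every positive integer $\eta=1,\dots,N-(c+r)-1$ and every sequence of ascending indices $0\leqslant v_1<\cdots<v_\eta\leqslant N$ (with $N,c,r$ as in (i)), there holds the codimension estimate $$\operatorname{codim}\mathscr{M}_{2c+r}^{N-\eta}\ \geqslant\ \dim\,{}_{v_1,\dots,v_\eta}\overset{\circ}{\mathbb{P}}(\mathrm{T}_{\mathbb{P}^N})=2N-\eta-1 .$$
   Context: For integers $m\geqslant 1$ and $M\geqslant 1$, $\mathscr{M}_{m}^{M}\subset\mathsf{Mat}_{m\times 2(M+1)}(\mathbb{K})$ is the algebraic subvariety of all $m\times 2(M+1)$ matrices $(\alpha_0\mid\alpha_1\mid\cdots\mid\alpha_M\mid\beta_0\mid\beta_1\mid\cdots\mid\beta_M)$ (written by columns) such that: (a) the sum of all the columns is zero: $\alpha_0+\cdots+\alpha_M+\beta_0+\cdots+\beta_M=\mathbf{0}$; (b) for every $\nu=0,\dots,M$: $\operatorname{rank}_{\mathbb{K}}\{\alpha_0,\dots,\widehat{\alpha_\nu},\dots,\alpha_M,\ \alpha_\nu+(\beta_0+\beta_1+\cdots+\beta_M)\}\leqslant M-1$; (c) for every $\tau=0,\dots,M-1$ and every $\rho=\tau+1,\dots,M$: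 $\operatorname{rank}_{\mathbb{K}}\{\alpha_0+\beta_0,\dots,\alpha_\tau+\beta_\tau,\ \alpha_{\tau+1},\dots,\widehat{\alpha_\rho},\dots,\alpha_M,\ \alpha_\rho+(\beta_{\tau+1}+\cdots+\beta_M)\}\leqslant M-1$. Here a hat means omission. Codimensions of $\mathscr{M}_m^M$ are taken in $\mathsf{Mat}_{m\times 2(M+1)}(\mathbb{K})$. $\mathbb{P}(\mathrm{T}_{\mathbb{P}^N})$ is the projectivized tangent bundle of $\mathbb{P}^N_{\mathbb{K}}$ (pairs of a point $[z]$ and a line in $\mathrm{T}_{\mathbb{P}^N}|_{[z]}$), $\overset{\circ}{\mathbb{P}}(\mathrm{T}_{\mathbb{P}^N})$ is its open part where $z_0\cdots z_N\neq0$, and ${}_{v_1,\dots,v_\eta}\overset{\circ}{\mathbb{P}}(\mathrm{T}_{\mathbb{P}^N})$ is the locus of $\mathbb{P}(\mathrm{T}_{\mathbb{P}^N})$ where $z_{v_1}=\cdots=z_{v_\eta}=0$ and all other coordinates of $z$ are nonzero. *)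

(* Defs.v *)
From HB Require Import structures.
From mathcomp Require Import all_boot all_order all_algebra.
From mathcomp Require Import generic_quotient.
From mathcomp Require Import mpoly.
From mathcomp Require Import boolp classical_sets functions.
From mathcomp Require Import topology_structure initial_topology.
From mathcomp Require Import subtype_topology quotient_topology.

Set Implicit Arguments.
Unset Strict Implicit.
Unset Printing Implicit Defensive.

Import GRing.Theory.

Local Open Scope quotient_scope.
Local Open Scope classical_set_scope.
Local Open Scope ring_scope.

(** * Dimension of a topological space *)

Definition irreducible_set (T : topologicalType) (Z : set T) : Prop :=
  Z !=set0 /\
  forall A B : set T, closed A -> closed B ->
    Z `<=` A `|` B -> Z `<=` A \/ Z `<=` B.

(* [Z 0 < Z 1 < ... < Z l]: a chain of length [l] has [l + 1] members. *)
Definition has_irreducible_chain (T : topologicalType) (l : nat) : Prop :=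
  exists Z : nat -> set T,
    (forall i, (i <= l)%N -> closed (Z i) /\ irreducible_set (Z i)) /\
    (forall i, (i < l)%N -> Z i `<` Z i.+1).

(* Krull dimension, as a relation: [krull_dim T d] says that the supremum of
   the lengths of chains of irreducible closed subsets is finite, equal to
   [d]. It holds for at most one [d], and for none if [T] is empty. *)
Definition krull_dim (T : topologicalType) (d : nat) : Prop :=
  has_irreducible_chain T d /\
  forall l, has_irreducible_chain T l -> (l <= d)%N.

(* [set_type X] carries the subspace topology. *)
Definition dim_is (T : topologicalType) (X : set T) (d : nat) : Prop :=
  krull_dim (set_type X) d.

(* [codim X = dim T - dim X]; only meant for irreducible [T] of finite
   dimension, here an affine space. *)
Definition codim_is (T : topologicalType) (X : set T) (k : nat) : Prop :=
  exists dT dX : nat, [/\ krull_dim T dT, dim_is X dX & dT = (dX + k)%N].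

(** * The Zariski topology on the affine space of matrices *)

(* An alias of ['M[K]_(m, n)], so as not to inherit the product topology. *)
Definition zmatrix (K : closedFieldType) (m n : nat) : Type := 'M[K]_(m, n).

HB.instance Definition _ (K : closedFieldType) (m n : nat) :=
  Choice.on (zmatrix K m n).

(* The variables of the polynomials are the entries, numbered by [mxvec]. *)
Definition zero_locus (K : closedFieldType) (m n : nat)
    (S : set {mpoly K[m * n]}) : set (zmatrix K m n) :=
  [set A | forall p, S p -> p.@[fun i => mxvec A 0 i] = 0].

Definition zariski_open (K : closedFieldType) (m n : nat) :
    set_system (zmatrix K m n) :=
  [set U | exists S : set {mpoly K[m * n]}, ~` U = zero_locus S].

Lemma zariski_openT (K : closedFieldType) (m n : nat) :
  zariski_open (setT : set (zmatrix K m n)).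
Proof.
exists [set 1]; rewrite setCT; apply/seteqP; split => // A /(_ 1 erefl).
by rewrite meval1 => /eqP; rewrite oner_eq0.
Qed.

Lemma zariski_openI (K : closedFieldType) (m n : nat) :
  setI_closed (@zariski_open K m n).
Proof.
move=> U V [S US] [S' VS'].
exists [set r | exists p q, [/\ S p, S' q & r = p * q]].
rewrite setCI US VS'; apply/seteqP; split => A.
  move=> [AS|AS'] _ [p [q [Sp Sq ->]]]; rewrite mevalM.
    by rewrite (AS p Sp) mul0r.
  by rewrite (AS' q Sq) mulr0.
move=> AM; have [AS|NAS] := pselect (zero_locus S A); first by left.
right=> q Sq; apply: contrapT => nq0; apply: NAS => p Sp.
have /eqP := AM (p * q) (ex_intro _ p (ex_intro _ q (And3 Sp Sq erefl))).
by rewrite mevalM mulf_eq0 => /orP[/eqP//|/eqP].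
Qed.

Lemma zariski_open_bigU (K : closedFieldType) (m n : nat) (I : Type)
    (f : I -> set (zmatrix K m n)) :
  (forall i, zariski_open (f i)) -> zariski_open (\bigcup_i f i).
Proof.
move=> fo; exists [set p | exists i S, ~` f i = zero_locus S /\ S p].
apply/seteqP; split => A.
  move=> nA p [i [S [fS Sp]]]; have : zero_locus S A.
    by rewrite -fS => fA; apply: nA; exists i.
  exact.
move=> AS [i _ fA]; have [S fS] := fo i.
have : (~` f i) A by rewrite fS => p Sp; apply: AS; exists i, S.
exact.
Qed.

HB.instance Definition _ (K : closedFieldType) (m n : nat) :=
  isOpenTopological.Build (zmatrix K m n)
    (@zariski_openT K m n) (@zariski_openI K m n) (@zariski_open_bigU K m n).

(** * The variety M_m^M *)

(* The columns 0..M of [A] are alpha_0..alpha_M, and the columns M+1..2M+1 are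
   beta_0..beta_M. *)
Definition alpha (K : closedFieldType) (m M : nat)
    (A : zmatrix K m (M.+1 + M.+1)) (i : 'I_M.+1) : 'cV[K]_m :=
  col (lshift M.+1 i) A.

Definition beta (K : closedFieldType) (m M : nat)
    (A : zmatrix K m (M.+1 + M.+1)) (i : 'I_M.+1) : 'cV[K]_m :=
  col (rshift M.+1 i) A.

Definition col_rank (K : closedFieldType) (m n : nat)
    (u : 'I_n -> 'cV[K]_m) : nat :=
  \rank (\matrix_(i < m, j < n) u j i 0).

(* Each family below has [M + 1] members; the member that involves alpha_nu,
   resp. alpha_rho, is listed at its own index. *)
Definition family_b (K : closedFieldType) (m M : nat)
    (A : zmatrix K m (M.+1 + M.+1)) (nu j : 'I_M.+1) : 'cV[K]_m :=
  if j == nu then alpha A nu + \sum_(k < M.+1) beta A k else alpha A j.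

Definition family_c (K : closedFieldType) (m M : nat)
    (A : zmatrix K m (M.+1 + M.+1)) (tau rho j : 'I_M.+1) : 'cV[K]_m :=
  if (j <= tau)%N then alpha A j + beta A j
  else if j == rho then alpha A rho + \sum_(k < M.+1 | (tau < k)%N) beta A k
  else alpha A j.

Definition MM (K : closedFieldType) (m M : nat) :
    set (zmatrix K m (M.+1 + M.+1)) :=
  [set A |
    [/\ \sum_(i < M.+1) alpha A i + \sum_(i < M.+1) beta A i = 0,
        forall nu : 'I_M.+1, (col_rank (family_b A nu) <= M - 1)%N
      & forall tau rho : 'I_M.+1, (tau < rho)%N ->
          (col_rank (family_c A tau rho) <= M - 1)%N]].

(** * The projectivized tangent bundle of P^N *)

(* By the Euler sequence, [T_{P^N}] at [z] is [K^(N+1) / K z] (up to the scalar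
   choice of [z]): a point of P(T_{P^N}) is the class of a pair (z, xi) with
   [z != 0] and [xi] outside the line [K z]. The pair is encoded as the matrix
   with rows [z] and [xi]. *)
Definition tangent_pairs (K : closedFieldType) (N : nat) :
    set (zmatrix K 2 N.+1) :=
  [set A : zmatrix K 2 N.+1 |
    row 0 A != 0 /\ ~ exists nu : K, row 1 A = nu *: row 0 A].

Definition tangent_pair (K : closedFieldType) (N : nat) : Type :=
  set_type (@tangent_pairs K N).

HB.instance Definition _ (K : closedFieldType) (N : nat) :=
  Topological.on (tangent_pair K N).

Definition pt_z (K : closedFieldType) (N : nat) (P : tangent_pair K N) :
    'rV[K]_N.+1 := row 0 (set_val P : 'M[K]_(2, N.+1)).

Definition pt_xi (K : closedFieldType) (N : nat) (P : tangent_pair K N) :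
    'rV[K]_N.+1 := row 1 (set_val P : 'M[K]_(2, N.+1)).

Definition same_tangent_line (K : closedFieldType) (N : nat) :
    rel (tangent_pair K N) :=
  fun P Q => `[< exists lambda mu nu : K,
    [/\ lambda != 0, mu != 0, pt_z Q = lambda *: pt_z P
      & pt_xi Q = mu *: pt_xi P + nu *: pt_z P] >].

Lemma same_tangent_line_refl (K : closedFieldType) (N : nat) :
  reflexive (@same_tangent_line K N).
Proof.
move=> P; apply/asboolP; exists 1, 1, 0.
by rewrite !scale1r scale0r addr0 oner_eq0.
Qed.

Lemma same_tangent_line_sym (K : closedFieldType) (N : nat) :
  ssrbool.symmetric (@same_tangent_line K N).
Proof.
suff H P Q : same_tangent_line P Q -> @same_tangent_line K N Q P.
  by move=> P Q; apply/idP/idP; exact: H.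
move=> /asboolP[l [m [n [l0 m0 zE xE]]]]; apply/asboolP.
exists l^-1, m^-1, (- (m^-1 * n * l^-1)); rewrite !invr_eq0 zE xE.
split => //; first by rewrite scalerA mulVf // scale1r.
rewrite scalerDr !scalerA mulVf // scale1r mulNr mulfVK //.
by rewrite scaleNr addrK.
Qed.

Lemma same_tangent_line_trans (K : closedFieldType) (N : nat) :
  transitive (@same_tangent_line K N).
Proof.
move=> Q P R /asboolP[l [m [n [l0 m0 zE xE]]]].
move=> /asboolP[l' [m' [n' [l0' m0' zE' xE']]]]; apply/asboolP.
exists (l' * l), (m' * m), (m' * n + n' * l); rewrite !mulf_neq0 //.
by rewrite zE' xE' zE xE scalerDr !scalerA scalerDl addrA.
Qed.

Canonical same_tangent_line_equiv (K : closedFieldType) (N : nat) :=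
  EquivRel (@same_tangent_line K N) (@same_tangent_line_refl K N)
    (@same_tangent_line_sym K N) (@same_tangent_line_trans K N).

(* The quotient of the space of pairs by the (regular, free) action of the
   group of triples (lambda, mu, nu) is locally trivial, so its Zariski
   topology is the quotient topology. *)
Definition PT (K : closedFieldType) (N : nat) : Type :=
  quotient_topology {eq_quot @same_tangent_line K N}.

HB.instance Definition _ (K : closedFieldType) (N : nat) :=
  Topological.on (PT K N).

HB.instance Definition _ (K : closedFieldType) (N : nat) :=
  Quotient.on (PT K N).

(* Homogeneous coordinates of the base point, for a chosen representative; only
   their vanishing matters below, and it does not depend on the choice. *)
Definition hcoord (K : closedFieldType) (N : nat) (p : PT K N)
    (j : 'I_N.+1) : K :=
  pt_z (repr p) 0 j.

Definition PT_open (K : closedFieldType) (N : nat) : set (PT K N) :=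
  [set p | \prod_(j < N.+1) hcoord p j != 0].

Definition PT_stratum (K : closedFieldType) (N eta : nat)
    (v : 'I_eta -> 'I_N.+1) : set (PT K N) :=
  [set p | (forall i : 'I_eta, hcoord p (v i) = 0) /\
           (forall j : 'I_N.+1, (forall i : 'I_eta, j <> v i) ->
              hcoord p j <> 0)].

(* Main.v *)
(* Dimensions are bounded through Hilbert functions. If [f] vanishes on [Z] but
   not on an irreducible [Z'] containing [Z], then polynomials independent on
   [Z], together with the multiples by [f] of polynomials independent on [Z'],
   are independent on [Z']. By induction a chain of length [l] forces at least
   binomial(t+l, l) independent functions of degree at most [e t], which is
   impossible for [l > d] on a finite union of polynomial images of [K^d].

   For M_m^M, put w = (alpha_0, ..., alpha_M, gamma_0, ..., gamma_(M-1)) with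
   gamma_i = alpha_i + beta_i. Conditions (b) with nu = M, 0 and (c) with
   rho = tau + 1 say that each of the M + 2 windows of M consecutive terms of w
   is dependent. In the window starting at i some w_t is a combination of
   w_i, ..., w_(t-1). For a given t let s be the last window charged to it: w_t
   then depends on t - s parameters instead of m, while at most M - (t - s)
   windows are charged to t. As M <= m, at least M + 2 parameters are saved, to
   which condition (a) adds m.

   For the strata of P(T_{P^N}), chains are pulled back to the space of pairs
   (z, xi), where fibres are 3-dimensional and irreducible. *)
Require Import Defs.
From mathcomp Require Import all_boot all_order all_algebra.
From mathcomp Require Import generic_quotient.
From mathcomp Require Import mpoly.
From mathcomp Require Import boolp classical_sets functions.
From mathcomp Require Import topology_structure.
From mathcomp Require Import subtype_topology quotient_topology.
From mathcomp Require Import zify ring.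

Set Implicit Arguments.
Unset Strict Implicit.
Unset Printing Implicit Defensive.

Import GRing.Theory.

Local Open Scope quotient_scope.
Local Open Scope classical_set_scope.
Local Open Scope ring_scope.

(** * Hilbert functions *)

Lemma exists_left_kernel (F : fieldType) (a b : nat) (A : 'M[F]_(a, b)) :
  (b < a)%N -> exists2 c : 'rV[F]_a, c != 0 & c *m A = 0.
Proof.
move=> lt_ba; have /rowV0Pn[c cK c0] : kermx A != 0.
  rewrite kermx_eq0 /row_free; apply/negP => /eqP rA.
  by have := rank_leq_col A; rewrite rA leqNgt lt_ba.
by exists c => //; apply/sub_kermxP.
Qed.

Section DegreeBounds.
Variable F : fieldType.

Lemma msizeM_leS n (p q : {mpoly F[n]}) a b :
  (msize p <= a.+1)%N -> (msize q <= b.+1)%N -> (msize (p * q) <= (a + b).+1)%N.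
Proof.
move=> pa qb; have [->|p0] := eqVneq p 0; first by rewrite mul0r msize0.
have [->|q0] := eqVneq q 0; first by rewrite mulr0 msize0.
by rewrite msizeM // -subn1 leq_subLR add1n -addSn -addnS leq_add.
Qed.

Lemma msize_sum_le n (I : Type) (r : seq I) (P : pred I)
    (G : I -> {mpoly F[n]}) a :
  (forall i, (msize (G i) <= a)%N) -> (msize (\sum_(i <- r | P i) G i) <= a)%N.
Proof.
move=> Ga; apply: (big_ind (fun p => (msize p <= a)%N)) => //.
  by rewrite msize0.
by move=> p q pa qa; apply: (leq_trans (msizeD_le _ _)); rewrite geq_max pa.
Qed.

Lemma msize_comp_le n d (lq : n.-tuple {mpoly F[d]}) (p : {mpoly F[n]}) e s :
  (forall i, (msize (tnth lq i) <= e.+1)%N) -> (msize p <= s.+1)%N ->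
  (msize (p \mPo lq) <= (e * s).+1)%N.
Proof.
move=> lqe ps; rewrite comp_mpolyEX big_seq.
apply: (big_ind (fun p => (msize p <= (e * s).+1)%N)) => [|q r qs rs|m mp].
- by rewrite msize0.
- by apply: (leq_trans (msizeD_le _ _)); rewrite geq_max qs.
apply: (leq_trans (msizeZ_le _ _)); rewrite comp_mpolyX.
apply: (@leq_trans (e * mdeg m).+1); last first.
  by rewrite ltnS leq_mul2l -ltnS (leq_trans (msize_mdeg_lt mp)) ?orbT.
have exp_le (q : {mpoly F[d]}) k :
    (msize q <= e.+1)%N -> (msize (q ^+ k) <= (e * k).+1)%N.
  move=> qe; elim: k => [|k IH]; first by rewrite expr0 msize1.
  by rewrite exprS mulnS; apply: msizeM_leS.
rewrite mdegE big_distrr /=.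
apply: (big_ind2 (fun (q : {mpoly F[d]}) k => (msize q <= k.+1)%N)) => [|q a r b|i _].
- by rewrite msize1.
- exact: msizeM_leS.
- exact: exp_le.
Qed.

Lemma card_monomials_le d b : (#|{: 'X_{1..d < b.+1}}| <= b.+1 ^ d)%N.
Proof.
have <- : #|{: {ffun 'I_d -> 'I_b.+1}}| = (b.+1 ^ d)%N.
  by rewrite card_ffun !card_ord.
pose h (mm : 'X_{1..d < b.+1}) := [ffun i : 'I_d => inord (mm i) : 'I_b.+1].
apply: (@leq_card _ _ h) => m1 m2 eq_h; apply/val_inj/mnmP => i.
have lt_b (m : 'X_{1..d < b.+1}) : (m i < b.+1)%N.
  by apply: leq_ltn_trans (bmdeg m); rewrite mdegE (bigD1 i) //= leq_addr.
have := congr1 (fun g : {ffun 'I_d -> 'I_b.+1} => val (g i)) eq_h.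
by rewrite !ffunE /= !inordK.
Qed.

End DegreeBounds.

Section Growth.
Variable F : fieldType.

Definition vanishes n (p : {mpoly F[n]}) (X : set ('I_n -> F)) :=
  forall x, X x -> p.@[x] = 0.

(** [msize] exceeds the total degree by one, so [s] bounds the degrees. Independence is that of the
    functions on [X]. *)
Definition independent_polys n (X : set ('I_n -> F)) (s a : nat) :=
  exists p : 'I_a -> {mpoly F[n]}, (forall i, (msize (p i) <= s.+1)%N) /\
    forall c : 'I_a -> F, vanishes (\sum_i c i *: p i) X -> forall i, c i = 0.

(** [X] need not be closed in affine space; the condition says that its vanishing ideal is prime, or
    the whole ring if [X] is empty. *)
Definition poly_irreducible n (X : set ('I_n -> F)) :=
  forall p q : {mpoly F[n]}, vanishes (p * q) X -> vanishes p X \/ vanishes q X.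

(* The bound is the Hilbert function of an [l]-dimensional affine space; the
   factor [e] absorbs the degrees of the equations cutting out a chain. *)
Definition growth_ge n (X : set ('I_n -> F)) (l : nat) :=
  exists e, forall t, independent_polys X (e * t) 'C(t + l, l).

Definition poly_map d n (f : ('I_d -> F) -> ('I_n -> F)) :=
  exists q : n.-tuple {mpoly F[d]}, forall y i, f y i = (tnth q i).@[y].

Lemma independent_polysW n (X Y : set ('I_n -> F)) s s' a :
  X `<=` Y -> (s <= s')%N -> independent_polys X s a -> independent_polys Y s' a.
Proof.
move=> XY ss' [p [ps pi]]; exists p; split=> [i|c cY].
  exact: leq_trans (ps i) _.
by apply: pi => x /XY; apply: cY.
Qed.

Lemma independent_polys1 n (X : set ('I_n -> F)) s :
  X !=set0 -> independent_polys X s 1.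
Proof.
move=> [x Xx]; exists (fun=> 1); split=> [i|c /(_ _ Xx)]; first by rewrite msize1.
by rewrite big_ord1 mevalZ meval1 mulr1 => c0 i; rewrite ord1.
Qed.

(** A relation on [Y], restricted to [X] where [f] vanishes, kills the coefficients of the [p j].
    What remains is [f] times a combination of the [q j], and irreducibility of [Y] cancels [f]. *)
Lemma independent_polysD n (X Y : set ('I_n -> F)) f e s s' a b :
  X `<=` Y -> poly_irreducible Y -> vanishes f X -> ~ vanishes f Y ->
  (msize f <= e.+1)%N -> (e + s' <= s)%N ->
  independent_polys X s a -> independent_polys Y s' b ->
  independent_polys Y s (a + b).
Proof.
move=> XY irrY fX fY fe ess' [p [ps pi]] [q [qs qi]].
exists (fun i => match fintype.split i with inl j => p j | inr j => f * q j end).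
split=> [i|c cY].
  case: (fintype.split i) => j //; apply: leq_trans (msizeM_leS fe (qs j)) _.
  by rewrite ltnS.
have sumE : \sum_i c i *: match fintype.split i with inl j => p j | inr j => f * q j end
    = \sum_i c (lshift b i) *: p i + f * \sum_i c (rshift a i) *: q i.
  rewrite big_split_ord mulr_sumr; congr (_ + _); apply: eq_bigr => i _.
    by rewrite (unsplitK (inl i)).
  by rewrite (unsplitK (inr i)) scalerAr.
have cl i : c (lshift b i) = 0.
  apply: (pi (fun i => c (lshift b i))) => x Xx.
  by have := cY x (XY x Xx); rewrite sumE mevalD mevalM (fX x Xx) mul0r addr0.
have cr i : c (rshift a i) = 0.
  apply: (qi (fun i => c (rshift a i))).
  have [|//|//] := irrY f (\sum_i c (rshift a i) *: q i).
  move=> x Yx; have := cY x Yx; rewrite sumE big1 ?add0r // => j _.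
  by rewrite cl scale0r.
by move=> i; rewrite -(fintype.splitK i); case: (fintype.split i) => j /=.
Qed.

Lemma growth_ge0 n (X : set ('I_n -> F)) : X !=set0 -> growth_ge X 0.
Proof. by exists 0%N => t; rewrite bin0; apply: independent_polys1. Qed.

Lemma growth_geW n (X Y : set ('I_n -> F)) l :
  X `<=` Y -> growth_ge X l -> growth_ge Y l.
Proof.
by move=> XY [e eX]; exists e => t; apply: (independent_polysW XY _ (eX t)).
Qed.

(** Pascal's rule splits the count for [l + 1] at [t + 1] into the count for [l] at [t + 1],
    supplied by [X], and the count for [l + 1] at [t], supplied by [Y] after multiplication by [f].
    The step from [t] to [t + 1] pays for the degree of [f]. *)
Lemma growth_geS n (X Y : set ('I_n -> F)) f l :
  X `<=` Y -> poly_irreducible Y -> vanishes f X -> ~ vanishes f Y ->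
  growth_ge X l -> growth_ge Y l.+1.
Proof.
move=> XY irrY fX fY [e eX]; pose E := maxn e (msize f); exists E.
elim=> [|t IH].
  rewrite add0n binn; apply: independent_polys1.
  by apply: contrapT => Y0; apply: fY => x Yx; case: Y0; exists x.
rewrite addSn binS addnC.
have fE : (msize f <= E.+1)%N by rewrite /E; lia.
apply: (independent_polysD XY irrY fX fY fE _ _ IH); first by rewrite mulnS.
rewrite -addSnnS.
by apply: (independent_polysW _ _ (eX t.+1)); rewrite // leq_mul2r leq_maxl orbT.
Qed.

(** Pulled back along [f j], a polynomial of degree at most [s] has at most [(e * s + 1) ^ d]
    coefficients. With more than [#|J|] times as many polynomials, a nontrivial combination pulls
    back to zero on every piece, hence vanishes on [X]. *)
Lemma independent_polys_le n (X : set ('I_n -> F)) (J : finType) d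
    (f : J -> ('I_d -> F) -> ('I_n -> F)) :
  (forall j, poly_map (f j)) -> (forall x, X x -> exists j y, x = f j y) ->
  exists e, forall s a,
    independent_polys X s a -> (a <= #|J| * (e * s).+1 ^ d)%N.
Proof.
move=> /choice[q fq] Xf; pose e := (\max_j \max_i msize (tnth (q j) i))%N.
exists e => s a [p [ps pi]]; rewrite leqNgt; apply/negP => lt_a.
pose mon : finType := 'X_{1..d < (e * s).+1}.
pose A : 'M[F]_(a, #|{: (J * mon)%type}|) :=
  \matrix_(i, k) (p i \mPo q (enum_val k).1)@_((enum_val k).2 : 'X_{1..d < (e * s).+1}).
have [|c c0 cA] := exists_left_kernel A.
  rewrite card_prod; apply: leq_ltn_trans lt_a.
  by rewrite leq_mul2l card_monomials_le orbT.
case/eqP: c0; apply/rowP => i; rewrite mxE.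
apply: (pi (fun i => c 0 i)) => _ /Xf[j [y ->]].
have -> : f j y = (fun i => (tnth (q j) i).@[y]) by apply/funext => k; apply: fq.
rewrite -comp_mpoly_meval; suff -> : (\sum_i c 0 i *: p i) \mPo q j = 0.
  by rewrite meval0.
rewrite raddf_sum /= (eq_bigr (fun i => c 0 i *: (p i \mPo q j))); last first.
  by move=> k _; apply: comp_mpolyZ.
set r : {mpoly F[d]} := \sum_i _; have rs : (msize r <= (e * s).+1)%N.
  apply: msize_sum_le => k; apply: leq_trans (msizeZ_le _ _) _.
  apply: msize_comp_le => // l; rewrite leqW //.
  by apply: (bigmax_sup j) => //; exact: (bigmax_sup l).
rewrite (mpolywE rs) big1 // => mm _.
have /matrixP/(_ 0 (enum_rank (j, mm : mon))) := cA; rewrite !mxE => rm0.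
suff -> : r@_mm = 0 by rewrite scale0r.
rewrite -rm0 /r raddf_sum; apply: eq_bigr => k _.
by rewrite mxE enum_rankK /= mcoeffZ.
Qed.

Lemma growth_ge_le n (X : set ('I_n -> F)) (J : finType) d
    (f : J -> ('I_d -> F) -> ('I_n -> F)) l :
  (forall j, poly_map (f j)) -> (forall x, X x -> exists j y, x = f j y) ->
  growth_ge X l -> (l <= d)%N.
Proof.
move=> pf Xf [e1 eX]; have [e2 le_e2] := independent_polys_le pf Xf.
rewrite leqNgt; apply/negP => lt_dl.
pose e := (e2 * e1).+1; pose C := (l`! * (#|J| * e ^ d))%N.
(* [l! * C(t + l, l)] is a falling factorial, which is at least [(t + 1) ^ l]. *)
have bound t : (t.+1 ^ l <= C * t.+1 ^ d)%N.
  have ffact_ge k : (t.+1 ^ k <= (t + k) ^_ k)%N.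
    elim: k => [|k IH]; first by rewrite ffactn0.
    by rewrite addnS ffactSS expnS leq_mul //; lia.
  apply: leq_trans (ffact_ge l) _; rewrite -bin_ffact mulnC -mulnA leq_mul2l.
  apply/orP; right; apply: leq_trans (le_e2 _ _ (eX t)) _.
  rewrite -mulnA leq_mul2l -expnMn; apply/orP; right.
  have le_e : ((e2 * (e1 * t)).+1 <= e * t.+1)%N.
    by rewrite mulnA mulnS /e addSn ltnS mulSn addnA leq_addl.
  by case: (d) => // d'; rewrite leq_exp2r.
(* At [t = C] the bound would put a positive power of [C + 1] below [C]. *)
have := bound C; rewrite leqNgt => /negP[].
rewrite -(subnK lt_dl) addnS -addSn expnD ltn_mul2r expn_gt0 /=.
by rewrite expnS; apply: leq_trans (leq_pmulr _ _); rewrite ?expn_gt0.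
Qed.

End Growth.

(** * Zariski charts and chains of irreducible closed sets *)

Section Curves.
Variable K : closedFieldType.

Definition curve n (c : 'I_n -> {poly K}) (t : K) : 'I_n -> K :=
  fun i => (c i).[t].

Definition line n (x y : 'I_n -> K) (i : 'I_n) : {poly K} :=
  (x i)%:P + (y i - x i) *: 'X.

Lemma curve_line n (x y : 'I_n -> K) t :
  curve (line x y) t = fun i => x i + (y i - x i) * t.
Proof. by apply/funext => i; rewrite /curve /line !hornerE. Qed.

Lemma curve_line0 n (x y : 'I_n -> K) : curve (line x y) 0 = x.
Proof. by rewrite curve_line; apply/funext => i; rewrite mulr0 addr0. Qed.

Lemma curve_line1 n (x y : 'I_n -> K) : curve (line x y) 1 = y.
Proof. by rewrite curve_line; apply/funext => i; rewrite mulr1 addrC subrK. Qed.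

Lemma meval_curve n (c : 'I_n -> {poly K}) (p : {mpoly K[n]}) :
  exists P : {poly K}, forall t, p.@[curve c t] = P.[t].
Proof.
exists (\sum_(m <- msupp p) (p@_m)%:P * \prod_i c i ^+ m i) => t.
rewrite mevalE horner_sum; apply: eq_bigr => m _.
rewrite hornerM hornerC horner_prod; congr (_ * _); apply: eq_bigr => i _.
by rewrite horner_exp.
Qed.

(** If [p] is nonzero at [x] and [q] at [y], both restrict to nonzero polynomials on a curve through
    the two points. An algebraically closed field is infinite, so some [t] avoids their roots and
    those of [g]. *)
Lemma poly_irreducible_curves n (X : set ('I_n -> K)) :
  (forall x y, X x -> X y -> exists c g,
     [/\ curve c 0 = x, curve c 1 = y, g != 0 &
         forall t, g.[t] != 0 -> X (curve c t)]) ->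
  poly_irreducible X.
Proof.
move=> Xc p q pqX; apply: contrapT => /not_orP[].
move=> /existsNP[x /not_implyP[Xx px]] /existsNP[y /not_implyP[Xy qy]].
have [c [g [c0 c1 g0 gX]]] := Xc _ _ Xx Xy.
have [P PE] := meval_curve c p; have [Q QE] := meval_curve c q.
have P0 : P != 0 by apply/eqP => P0; apply: px; rewrite -c0 PE P0 horner0.
have Q0 : Q != 0 by apply/eqP => Q0; apply: qy; rewrite -c1 QE Q0 horner0.
have /closed_nonrootP[t] : g * P * Q != 0 by rewrite !mulf_neq0.
rewrite rootE !hornerM !mulf_eq0 !negb_or => /andP[/andP[gt Pt] Qt].
have /eqP := pqX _ (gX _ gt).
by rewrite mevalM PE QE mulf_eq0 (negPf Pt) (negPf Qt).
Qed.

End Curves.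

Section Charts.
Variable K : closedFieldType.

(** A relation covers both the embedding of a subspace of matrices and the representation of a
    tangent line by its many pairs. *)
Definition closed_algebraic n (T : topologicalType)
    (R : ('I_n -> K) -> T -> Prop) :=
  forall A : set T, closed A -> exists S : set {mpoly K[n]},
    forall x a, R x a -> A a <-> forall p, S p -> p.@[x] = 0.

(* [R x a]: the point [x] of the affine space represents the point [a]. *)
Definition zariski_chart n (T : topologicalType)
    (R : ('I_n -> K) -> T -> Prop) :=
  [/\ forall a, exists x, R x a,
      closed_algebraic R,
      forall p : {mpoly K[n]}, closed [set a | forall x, R x a -> p.@[x] = 0]
    & forall a, poly_irreducible [set x | R x a]].

(** The sets of representatives of the members form a chain in affine space. The smallest contains a
    whole fibre, which accounts for [k]; each strict inclusion adds one by [growth_geS], applied to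
    an equation of the smaller member that fails on the larger. *)
Lemma chain_length_le n (T : topologicalType) (R : ('I_n -> K) -> T -> Prop)
    (J : finType) d (f : J -> ('I_d -> K) -> ('I_n -> K)) k l :
  zariski_chart R ->
  (forall a, growth_ge [set x | R x a] k) ->
  (forall j, poly_map (f j)) ->
  (forall x a, R x a -> exists j y, x = f j y) ->
  has_irreducible_chain T l -> (l + k <= d)%N.
Proof.
move=> [surjR algR closedR irrR] growR polyf Rf [Z [Zirr Zlt]].
pose X i := [set x | exists2 a, Z i a & R x a].
have irrX i : (i <= l)%N -> poly_irreducible (X i).
  move=> il p q pqX; have [_ [_ Zi]] := Zirr i il.
  have [a Zia|ZA|ZB] := Zi _ _ (closedR p) (closedR q).
  - have [x Rxa|pa|qa] := irrR a p q; first by apply: pqX; exists a.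
      by left=> x /pa.
    by right=> x /qa.
  - by left=> x [a /ZA/= + Rxa]; apply.
  - by right=> x [a /ZB/= + Rxa]; apply.
have growX i : (i <= l)%N -> growth_ge (X i) (i + k).
  elim: i => [|i IH] il.
    have [_ [[a Za] _]] := Zirr 0%N il.
    by apply: growth_geW (growR a) => x Rxa; exists a.
  have [Zi_sub /existsNP[a /not_implyP[Za nZa]]] := Zlt i il.
  have [S SE] := algR _ (Zirr i (ltnW il)).1; have [x Rxa] := surjR a.
  have /existsNP[p /not_implyP[Sp px]] : ~ forall p, S p -> p.@[x] = 0.
    by move=> /(SE _ _ Rxa).
  rewrite addSn; apply: (@growth_geS _ _ (X i) _ p).
  - by move=> y [b /Zi_sub Zb Ryb]; exists b.
  - exact: irrX.
  - by move=> y [b Zb Ryb]; apply: (SE _ _ Ryb).1.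
  - by move=> pX; apply: px; apply: pX; exists a.
  - exact: IH (ltnW il).
apply: growth_ge_le polyf _ (growX l (leqnn l)) => x [a _ Rxa].
exact: Rf Rxa.
Qed.

(** The argument of [poly_irreducible_curves], with [p] an equation of [A] that fails at [a] and [q]
    an equation of [B] that fails at [b]. *)
Lemma irreducible_set_curves n (T : topologicalType)
    (R : ('I_n -> K) -> T -> Prop) (Z : set T) :
  closed_algebraic R -> Z !=set0 ->
  (forall a b, Z a -> Z b -> exists c g,
     [/\ R (curve c 0) a, R (curve c 1) b, g != 0 &
         forall t, g.[t] != 0 -> exists2 a', Z a' & R (curve c t) a']) ->
  irreducible_set Z.
Proof.
move=> algR Z0 Zc; split=> // A B clA clB ZAB; apply: contrapT => /not_orP[].
move=> /existsNP[a /not_implyP[Za nAa]] /existsNP[b /not_implyP[Zb nBb]].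
have [c [g [Ra Rb g0 gZ]]] := Zc _ _ Za Zb.
have [S SE] := algR _ clA; have [S' SE'] := algR _ clB.
have /existsNP[p /not_implyP[Sp pc]] : ~ forall p, S p -> p.@[curve c 0] = 0.
  by move=> /(SE _ _ Ra).
have /existsNP[q /not_implyP[Sq qc]] : ~ forall q, S' q -> q.@[curve c 1] = 0.
  by move=> /(SE' _ _ Rb).
have [P PE] := meval_curve c p; have [Q QE] := meval_curve c q.
have P0 : P != 0 by apply/eqP => P0; apply: pc; rewrite PE P0 horner0.
have Q0 : Q != 0 by apply/eqP => Q0; apply: qc; rewrite QE Q0 horner0.
have /closed_nonrootP[t] : g * P * Q != 0 by rewrite !mulf_neq0.
rewrite rootE !hornerM !mulf_eq0 !negb_or => /andP[/andP[gt Pt] Qt].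
have [a' /ZAB[Aa'|Ba'] Ra'] := gZ _ gt.
  by have /eqP := (SE _ _ Ra').1 Aa' _ Sp; rewrite PE (negPf Pt).
by have /eqP := (SE' _ _ Ra').1 Ba' _ Sq; rewrite QE (negPf Qt).
Qed.

End Charts.

Lemma krull_dim_le (T : topologicalType) (D : nat) :
  has_irreducible_chain T 0 ->
  (forall l, has_irreducible_chain T l -> (l <= D)%N) ->
  exists2 d, (d <= D)%N & krull_dim T d.
Proof.
move=> T0 TD.
have ex : exists l, `[< has_irreducible_chain T l >] by exists 0%N; apply/asboolP.
have bd l : `[< has_irreducible_chain T l >] -> (l <= D)%N by move/asboolP/TD.
case: (ex_maxnP ex bd) => d /asboolP Td dmax; exists d; first exact: TD.
by split=> // l /asboolP/dmax.
Qed.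

Lemma subtype_closedE (T : topologicalType) (X : set T) (A : set (set_type X)) :
  closed A -> exists2 B : set T, closed B & A = set_val @^-1` B.
Proof.
move=> /closed_openC[U oU UA]; exists (~` U); first exact: open_closedC.
by rewrite -preimage_setC UA setCK.
Qed.

Lemma subtype_closed (T : topologicalType) (X : set T) (B : set T) :
  closed B -> closed (set_val @^-1` B : set (set_type X)).
Proof.
by rewrite -!openC preimage_setC => oB; exists (~` B).
Qed.

Section AffineSpace.
Variables (K : closedFieldType) (m n : nat).
Implicit Types X : set (zmatrix K m n).

Definition entries (A : zmatrix K m n) : 'I_(m * n) -> K := fun i => mxvec A 0 i.

Definition of_entries (x : 'I_(m * n) -> K) : zmatrix K m n := vec_mx (\row_i x i).

Lemma of_entriesK x : entries (of_entries x) = x.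
Proof. by apply/funext => i; rewrite /entries vec_mxK mxE. Qed.

Lemma entriesK A : of_entries (entries A) = A.
Proof.
by rewrite -[RHS]mxvecK; congr vec_mx; apply/rowP => i; rewrite mxE.
Qed.

Lemma closed_zero_locus (S : set {mpoly K[m * n]}) : closed (@zero_locus K m n S).
Proof. by rewrite -openC; exists S; rewrite setCK. Qed.

Lemma closed_zariskiE (A : set (zmatrix K m n)) :
  closed A -> exists S, A = @zero_locus K m n S.
Proof. by rewrite -openC => -[S]; rewrite setCK; exists S. Qed.

End AffineSpace.

Section AffineChart.
Variables (K : closedFieldType) (m n : nat).
Variables (T : topologicalType) (iota : T -> zmatrix K m n).
Hypothesis closed_pullback : forall A : set T, closed A ->
  exists2 B : set (zmatrix K m n), closed B & A = iota @^-1` B.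
Hypothesis pullback_closed : forall B : set (zmatrix K m n),
  closed B -> closed (iota @^-1` B).

Definition represents (x : 'I_(m * n) -> K) (a : T) := x = entries (iota a).

Lemma represents_algebraic : closed_algebraic represents.
Proof.
move=> A /closed_pullback[B clB ->].
by have [S ->] := closed_zariskiE clB; exists S => x a ->.
Qed.

Lemma represents_chart : zariski_chart represents.
Proof.
split=> [a||p|a]; first by exists (entries (iota a)).
- exact: represents_algebraic.
- have -> : [set a | forall x, represents x a -> p.@[x] = 0] =
            iota @^-1` @zero_locus K m n [set p].
    by apply/seteqP; split=> a pa => [q ->|x ->]; exact: pa.
  by apply: pullback_closed; exact: closed_zero_locus.
- move=> p q pq0; have /eqP := pq0 (entries (iota a)) erefl.
  by rewrite mevalM mulf_eq0 => /orP[]/eqP p0; [left|right] => x ->.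
Qed.

(** Each point has a single representative, so the fibres contribute [k = 0]. *)
Lemma affine_chain_le (J : finType) d
    (f : J -> ('I_d -> K) -> ('I_(m * n) -> K)) l :
  (forall j, poly_map (f j)) ->
  (forall a, exists j y, entries (iota a) = f j y) ->
  has_irreducible_chain T l -> (l <= d)%N.
Proof.
move=> pf Tf chain.
have := chain_length_le represents_chart (k := 0) _ pf _ chain.
rewrite addn0; apply=> [a|x a ->]; last exact: Tf.
by apply: growth_ge0; exists (entries (iota a)).
Qed.

End AffineChart.

(** * Polynomial parametrizations *)

Section PolynomialFunctions.
Variable F : fieldType.

Definition poly_fun d (g : ('I_d -> F) -> F) :=
  exists q : {mpoly F[d]}, forall y, g y = q.@[y].

Lemma poly_funP d n (f : ('I_d -> F) -> ('I_n -> F)) :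
  (forall i, poly_fun (fun y => f y i)) -> poly_map f.
Proof.
move=> /choice[q qE]; exists [tuple q i | i < n] => y i.
by rewrite tnth_mktuple.
Qed.

Lemma poly_fun_const d c : @poly_fun d (fun=> c).
Proof. by exists c%:MP => y; rewrite mevalC. Qed.

Lemma poly_fun_var d i : @poly_fun d (fun y => y i).
Proof. by exists 'X_i => y; rewrite mevalXU. Qed.

Lemma poly_funD d (g h : ('I_d -> F) -> F) :
  poly_fun g -> poly_fun h -> poly_fun (fun y => g y + h y).
Proof. by move=> [p pE] [q qE]; exists (p + q) => y; rewrite mevalD pE qE. Qed.

Lemma poly_funN d (g : ('I_d -> F) -> F) :
  poly_fun g -> poly_fun (fun y => - g y).
Proof. by move=> [p pE]; exists (- p) => y; rewrite mevalN pE. Qed.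

Lemma poly_funM d (g h : ('I_d -> F) -> F) :
  poly_fun g -> poly_fun h -> poly_fun (fun y => g y * h y).
Proof. by move=> [p pE] [q qE]; exists (p * q) => y; rewrite mevalM pE qE. Qed.

Lemma poly_fun_sum d (I : finType) (g : I -> ('I_d -> F) -> F) :
  (forall i, poly_fun (g i)) -> poly_fun (fun y => \sum_i g i y).
Proof.
move=> /choice[q qE]; exists (\sum_i q i) => y.
by rewrite raddf_sum; apply: eq_bigr => i _; rewrite qE.
Qed.

Lemma poly_fun_reindex d d' (s : 'I_d' -> 'I_d) (g : ('I_d' -> F) -> F) :
  poly_fun g -> poly_fun (fun y => g (y \o s)).
Proof.
move=> [q qE]; exists (q \mPo [tuple 'X_(s i) | i < d']) => y.
rewrite comp_mpoly_meval qE; apply: meval_eq => i.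
by rewrite tnth_mktuple mevalXU.
Qed.

Definition coordinate_embedding n (J : {set 'I_n}) (y : 'I_#|J| -> F) (i : 'I_n) : F :=
  if [pick k | enum_val k == i] is Some k then y k else 0.

Lemma coordinate_embedding_poly n (J : {set 'I_n}) :
  poly_map (@coordinate_embedding n J).
Proof.
apply: poly_funP => i; rewrite /coordinate_embedding.
by case: pickP => [k _|_]; [exact: poly_fun_var|exact: poly_fun_const].
Qed.

Lemma coordinate_embedding_onto n (J : {set 'I_n}) (x : 'I_n -> F) :
  (forall i, i \notin J -> x i = 0) -> exists y, x = @coordinate_embedding n J y.
Proof.
move=> xJ; exists (fun k => x (enum_val k)); apply/funext => i.
rewrite /coordinate_embedding; case: pickP => [k /eqP-> //|noJ].
apply: xJ; apply/negP => iJ.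
by have := noJ (enum_rank_in iJ i); rewrite enum_rankK_in ?eqxx.
Qed.

End PolynomialFunctions.

(** * Dimension of the affine space of matrices *)

Section AffineDimension.
Variables (K : closedFieldType) (m n : nat).

Let closed_id (A : set (zmatrix K m n)) : closed A ->
  exists2 B : set (zmatrix K m n), closed B & A = idfun @^-1` B.
Proof. by exists A. Qed.

Let id_closed (B : set (zmatrix K m n)) : closed B -> closed (idfun @^-1` B).
Proof. by []. Qed.

Lemma affine_space_dim : krull_dim (zmatrix K m n) (m * n).
Proof.
split; last first.
  move=> l; rewrite -[X in (_ <= X)%N]card_ord -cardsT.
  apply: (affine_chain_le closed_id id_closed (J := unit)) => [j|a].
    exact: coordinate_embedding_poly.
  exists tt; apply: coordinate_embedding_onto => i.
  by rewrite inE.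
(* The flag of coordinate subspaces: only the first [i] entries are free in member [i]. *)
exists (fun i => [set A | forall j : 'I_(m * n), (i <= j)%N -> entries A j = 0]).
split=> [i imn|i imn].
  split.
    have -> : [set A : zmatrix K m n |
        forall j : 'I_(m * n), (i <= j)%N -> entries A j = 0] =
      zero_locus [set p | exists2 j : 'I_(m * n), (i <= j)%N & p = 'X_j].
      apply/seteqP; split=> A AZ => [p [j ij ->]|j ij].
        by rewrite mevalXU; apply: AZ.
      by have := AZ 'X_j (ex_intro2 _ _ j ij erefl); rewrite mevalXU.
    exact: closed_zero_locus.
  apply: (irreducible_set_curves (represents_algebraic closed_id)).
    by exists (of_entries (fun=> 0)) => j _; rewrite of_entriesK.
  move=> A B AZ BZ; exists (line (entries A) (entries B)), 1.
  rewrite oner_eq0 curve_line0 curve_line1; split=> // t _.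
  exists (of_entries (curve (line (entries A) (entries B)) t)); last first.
    by rewrite /represents of_entriesK.
  by move=> j ij; rewrite of_entriesK curve_line AZ // BZ // subr0 mul0r addr0.
split=> [A AZ j /ltnW|]; first exact: AZ.
(* The basis vector of coordinate [i] lies in member [i + 1] but not in member [i]. *)
pose A : zmatrix K m n := of_entries (fun j => (j == i :> nat)%:R).
move=> /(_ A) H; have AZ : forall j : 'I_(m * n), (i.+1 <= j)%N -> entries A j = 0.
  by move=> j ij; rewrite of_entriesK gtn_eqF.
have /eqP := H AZ (Ordinal imn) (leqnn i).
by rewrite of_entriesK /= eqxx oner_eq0.
Qed.

End AffineDimension.

(** * Vector sequences with prescribed linear dependences *)

Section VectorSequences.
Variables (K : fieldType) (m : nat).
Implicit Types w : nat -> 'I_m -> K.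

(** For [t = s] the sum is empty and the condition reads [w t = 0]. *)
Definition combination_at w s t :=
  exists c : nat -> K, forall j, w t j = \sum_(k < t - s) c k * w (s + k)%N j.

(* The sequences [w] with property [P] are, up to their first [t] terms,
   polynomial functions of [d] parameters. *)
Definition parametrized (P : set (nat -> 'I_m -> K)) d t :=
  exists f : ('I_d -> K) -> nat -> 'I_m -> K,
    (forall i j, poly_fun (fun y => f y i j)) /\
    (forall w, P w -> exists y, forall i j, (i < t)%N -> f y i j = w i j).

Lemma parametrized0 P : parametrized P 0 0.
Proof.
exists (fun _ _ _ => 0); split=> [i j|w _]; first exact: poly_fun_const.
by exists (fun=> 0).
Qed.

Lemma parametrizedW P d d' t : (d <= d')%N -> parametrized P d t -> parametrized P d' t.
Proof.
move=> dd' [f [pf Pf]]; exists (fun y => f (y \o widen_ord dd')); split=> [i j|w].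
  exact: (poly_fun_reindex (widen_ord dd') (pf i j)).
move=> /Pf[y fy]; exists (fun i => if insub (val i) is Some k then y k else 0) => i j.
move=> it; rewrite -fy //; congr (f _ i j); apply/funext => k /=.
by rewrite valK.
Qed.

(** [g] produces term [t] from [e] fresh parameters and the earlier terms. It is tested on every
    [w'] that agrees with [w] before [t], since the sequence built so far is known to be right only
    there. *)
Lemma parametrized_step P d e t (g : ('I_e -> K) -> (nat -> 'I_m -> K) -> 'I_m -> K) :
  (forall d' (f : ('I_d' -> K) -> nat -> 'I_m -> K) (s : 'I_e -> 'I_d') j,
     (forall i j, poly_fun (fun y => f y i j)) ->
     poly_fun (fun y => g (y \o s) (f y) j)) ->
  (forall w, P w -> exists y, forall w' : nat -> 'I_m -> K,
     (forall i j, (i < t)%N -> w' i j = w i j) -> g y w' =1 w t) ->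
  parametrized P d t -> parametrized P (d + e) t.+1.
Proof.
move=> pg Pg [f [pf Pf]].
exists (fun y i => if i == t then g (y \o @rshift d e) (f (y \o @lshift d e))
                   else f (y \o @lshift d e) i); split=> [i j|w Pw].
  case: (i == t); last exact: (poly_fun_reindex _ (pf i j)).
  apply: (pg _ (fun y => f (y \o @lshift d e)) (@rshift d e)) => i' j'.
  exact: (poly_fun_reindex _ (pf i' j')).
have [y1 fy1] := Pf w Pw; have [y2 gy2] := Pg w Pw.
exists (fun i => match fintype.split i with inl k => y1 k | inr k => y2 k end) => i j.
set y := (X in X \o _).
have -> : y \o @lshift d e = y1 by apply/funext => k; rewrite /y /= (unsplitK (inl k)).
have -> : y \o @rshift d e = y2 by apply/funext => k; rewrite /y /= (unsplitK (inr k)).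
rewrite ltnS leq_eqVlt; case: eqP => [-> _|_] /=; last exact: fy1.
exact: gy2.
Qed.

Lemma parametrized_free P d t : parametrized P d t -> parametrized P (d + m) t.+1.
Proof.
apply: (parametrized_step (g := fun y _ j => y j)) => [d' f s j _|w _].
  exact: poly_fun_var.
by exists (w t).
Qed.

Lemma parametrized_combination P d s t : (s <= t)%N ->
  (forall w, P w -> combination_at w s t) ->
  parametrized P d t -> parametrized P (d + (t - s)) t.+1.
Proof.
move=> st Pst.
apply: (parametrized_step (g := fun y w j => \sum_k y k * w (s + k)%N j)).
  move=> d' f h j pf; apply: poly_fun_sum => k.
  by apply: poly_funM; [exact: poly_fun_var|exact: pf].
move=> w /Pst[c cE]; exists c => w' w'E j; rewrite cE; apply: eq_bigr => k _.
by rewrite w'E // -ltn_subRL.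
Qed.

(** The relation is solved for the last term with a nonzero coefficient. *)
Lemma exists_combination_at w i M (c : 'rV[K]_M) :
  c != 0 -> (forall j, \sum_k c 0 k * w (i + k)%N j = 0) ->
  exists o : 'I_M, combination_at w i (i + o).
Proof.
move=> /rV0Pn[k0 ck0] cw.
have [o co omax] := @arg_maxnP _ k0 (fun k => c 0 k != 0) (@nat_of_ord M) ck0.
exists o; pose C k := if insub k is Some k' then c 0 k' else 0 : K.
have CE (k : 'I_M) : C k = c 0 k by rewrite /C valK.
exists (fun k => - (c 0 o)^-1 * C k) => j; rewrite addKn.
under eq_bigr => k _ do rewrite -mulrA.
rewrite -mulr_sumr; set S := \sum_(k < o) _.
suff -> : S = - (c 0 o * w (i + o)%N j) by rewrite mulNr mulrN opprK mulKf.
apply/eqP; rewrite -addr_eq0; apply/eqP; rewrite -[RHS](cw j).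
have -> : \sum_k c 0 k * w (i + k)%N j = \sum_(0 <= k < M) C k * w (i + k)%N j.
  by rewrite big_mkord; apply: eq_bigr => k _; rewrite CE.
rewrite (big_cat_nat _ (n := o)) ?(ltnW (ltn_ord o)) //= [X in _ = _ + X]big_ltn // CE.
rewrite [X in _ = _ + (_ + X)]big_nat_cond [X in _ = _ + (_ + X)]big1; last first.
  move=> k /andP[/andP[ok kM] _]; rewrite (CE (Ordinal kM)).
  have [->|/omax/=] := eqVneq (c 0 (Ordinal kM)) 0; first by rewrite mul0r.
  by rewrite leqNgt ok.
by rewrite addr0 /S big_mkord.
Qed.

End VectorSequences.

(** * Counting the parameters saved by the windows *)

Section WindowCount.
Variables (m M : nat) (o : {ffun 'I_M.+2 -> 'I_M}).
Hypothesis le_Mm : (M <= m)%N.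

(** [o i] is the offset, in the window starting at [i], of the term to which that window is
    charged. *)
Definition window_target (i : 'I_M.+2) : nat := (i + o i)%N.

(** The latest charged window gives the shortest combination. If no window is charged the maximum is
    0, a value that [param_count] does not read. *)
Definition window_start t := (\max_(i | window_target i == t) i)%N.

Definition param_count t :=
  if [exists i, window_target i == t] then (t - window_start t)%N else m.

Lemma window_startP t : [exists i, window_target i == t] ->
  exists i, window_target i = t /\ window_start t = i.
Proof.
pose A := [pred i | window_target i == t].
move=> /existsP[i0 i0t]; have [|i it iE] := @eq_bigmax_cond _ A (@nat_of_ord M.+2).
  by apply/card_gt0P; exists i0.
exists i; split; first exact/eqP.
by rewrite -iE; apply: eq_bigl => k; rewrite inE.
Qed.

Lemma param_count_le t : (param_count t + #|[pred i | window_target i == t]| <= m)%N.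
Proof.
rewrite /param_count; case: ifPn => [ex|nex]; last first.
  rewrite eq_card0 ?addn0 // => i; rewrite inE; apply/negP => it.
  by case/existsP: nex; exists i.
have i0max i : window_target i == t -> (i <= window_start t)%N.
  by move=> it; rewrite /window_start (bigmax_sup i).
have [i0 [i0t i0E]] := window_startP ex.
have [o_lt le_it] : (o i0 < M)%N /\ (t = window_start t + o i0)%N.
  by rewrite ltn_ord i0E -i0t.
move: (window_start t) => s in i0max le_it *.
(* A charged window starts at some [i] with [t - M < i <= s], so the distances [s - i] are distinct
   and below [s + M - t]. *)
have : (#|[pred i | window_target i == t]| <= s + M - t)%N.
  rewrite cardE -(size_map (@nat_of_ord M.+2)).
  rewrite -[X in (_ <= X)%N](size_iota 0) -[X in (_ <= X)%N](size_map (subn s)).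
  apply: uniq_leq_size.
    by rewrite map_inj_uniq ?enum_uniq //; exact: ord_inj.
  move=> _ /mapP[i + ->]; rewrite mem_enum inE => it.
  have le_is := i0max _ it; apply/mapP; exists (s - i)%N; last by rewrite subKn.
  rewrite mem_iota leq0n add0n; move/eqP: it; rewrite /window_target.
  by have := ltn_ord (o i); lia.
lia.
Qed.

(** Each of the [M + 2] windows is charged to exactly one term, of index at most
    [(M + 1) + (M - 1) = 2M]; it remains to sum [param_count_le]. *)
Lemma param_count_sum :
  (\sum_(t < M.*2.+1) param_count t + M.+2 <= m * M.*2.+1)%N.
Proof.
have <- : (\sum_(t < M.*2.+1) #|[pred i | window_target i == t]| = M.+2)%N.
  rewrite -[RHS]card_ord -sum1_card.
  have lt_i (i : 'I_M.+2) : (window_target i < M.*2.+1)%N.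
    by rewrite /window_target; have := ltn_ord (o i); have := ltn_ord i; lia.
  rewrite (partition_big (fun i => Ordinal (lt_i i)) predT) //=.
  by apply: eq_bigr => t _; rewrite sum1_card.
rewrite -big_split /= -[X in (_ <= m * X)%N]card_ord mulnC -sum_nat_const.
by apply: leq_sum => t _; exact: param_count_le.
Qed.

End WindowCount.

(** * The variety M_m^M *)

Section MMDimension.
Variables (K : closedFieldType) (m M : nat).
Hypotheses (M_gt0 : (0 < M)%N) (le_Mm : (M <= m)%N).

Definition windowed (o : {ffun 'I_M.+2 -> 'I_M}) : set (nat -> 'I_m -> K) :=
  [set w | forall i : 'I_M.+2, combination_at w i (i + o i)].

Lemma windowed_parametrized o :
  parametrized (windowed o) (m * M.*2.+1 - M.+2) M.*2.+1.
Proof.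
apply: (@parametrizedW _ _ _ (\sum_(t < M.*2.+1) param_count m o t)).
  by have := param_count_sum o le_Mm; lia.
elim: (M.*2.+1) => [|t IH]; first by rewrite big_ord0; exact: parametrized0.
rewrite big_ord_recr /= /param_count; case: ifPn => [ex|_]; last first.
  exact: parametrized_free.
have [i [it ->]] := window_startP ex.
apply: parametrized_combination IH => [|w Pw]; last by rewrite -it; exact: Pw.
by rewrite -it leq_addr.
Qed.

Lemma col_rank_dependent n k (u : 'I_n -> 'cV[K]_m) (s : 'I_k -> 'I_n) :
  (col_rank u < k)%N ->
  exists2 c : 'rV[K]_k, c != 0 & forall j, \sum_i c 0 i * u (s i) j 0 = 0.
Proof.
move=> rk; pose B : 'M[K]_(k, m) := \matrix_(i, j) u (s i) j 0.
pose U : 'M[K]_(m, n) := \matrix_(i, j) u j i 0.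
have BE : B = (\matrix_(i, j) (s i == j)%:R) *m U^T.
  apply/matrixP => i j; rewrite !mxE (bigD1 (s i)) //= big1 => [|l ls].
    by rewrite !mxE eqxx mul1r addr0.
  by rewrite !mxE eq_sym (negPf ls) mul0r.
have /rowV0Pn[c cK c0] : kermx B != 0.
  rewrite kermx_eq0 /row_free; apply/negP => /eqP rB.
  have := mxrankM_maxr (\matrix_(i, j) (s i == j)%:R : 'M[K]_(k, n)) U^T.
  by rewrite -BE rB mxrank_tr leqNgt rk.
have /sub_kermxP/matrixP cB := cK.
exists c => // j; have := cB 0 j; rewrite !mxE => cBj; rewrite -[RHS]cBj.
by apply: eq_bigr => i _; rewrite mxE.
Qed.

(* [alpha_0, ..., alpha_M, alpha_0 + beta_0, ..., alpha_(M-1) + beta_(M-1)] *)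
Definition column_sequence (A : zmatrix K m (M.+1 + M.+1)) (i : nat) (j : 'I_m) : K :=
  if (i <= M)%N then alpha A (inord i) j 0
  else (alpha A (inord (i - M.+1)) + beta A (inord (i - M.+1))) j 0.

(** Dropping from a family of (b) or (c) the member modified by a sum of betas leaves the [M] terms
    of the window, up to order; [s] matches positions in the window with indices in the family. *)
Lemma window_combination A (i : 'I_M.+2) : MM A ->
  exists o : 'I_M, combination_at (column_sequence A) i (i + o).
Proof.
case=> _ rank_b rank_c.
pose s (k : 'I_M) : 'I_M.+1 :=
  if (i + k <= M)%N then inord (i + k) else inord (i + k - M.+1).
suff [u uE ur] : exists2 u : 'I_M.+1 -> 'cV[K]_m,
    (forall k j, u (s k) j 0 = column_sequence A (i + k) j) & (col_rank u < M)%N.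
  have [c c0 cu] := col_rank_dependent s ur.
  apply: (exists_combination_at c0) => j; rewrite -[RHS](cu j).
  by apply: eq_bigr => k _; rewrite uE.
(* Positivity of [M] makes the truncated [M - 1] strictly smaller than [M]. *)
have ltM n : (n <= M - 1)%N -> (n < M)%N by lia.
rewrite /column_sequence /s; case: i @s => -[|[|i]] /= lt_iM.
- exists (family_b A ord_max) => [k j|]; last exact/ltM/rank_b.
  have lt_k := ltn_ord k; rewrite add0n (ltnW lt_k) /family_b ifN //.
  by apply/eqP => /(congr1 val) /=; rewrite inordK; lia.
- exists (family_b A ord0) => [k j|]; last exact/ltM/rank_b.
  have lt_k := ltn_ord k; rewrite add1n lt_k /family_b ifN //.
  by apply/eqP => /(congr1 val) /=; rewrite inordK; lia.
- have lt_i : (i.+1 < M.+1)%N by lia.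
  exists (family_c A (inord i) (inord i.+1)) => [k j|]; last first.
    by apply/ltM/rank_c; rewrite !inordK // ltnW.
  have lt_k := ltn_ord k; rewrite /family_c; case: (leqP (i.+2 + k) M) => ikM.
    rewrite ifF; last by apply/negP; rewrite !inordK; lia.
    by rewrite ifF //; apply/eqP => /(congr1 val) /=; rewrite !inordK; lia.
  by rewrite ifT // !inordK; lia.
Qed.

(** The sequence has no term for [beta_M], which condition (a) determines from the others. This is
    the source of the summand [m] in the codimension. *)
Definition matrix_of_sequence (w : nat -> 'I_m -> K) : zmatrix K m (M.+1 + M.+1) :=
  \matrix_(j, k) match fintype.split k with
  | inl i => w i j
  | inr i => if (i < M)%N then w (M.+1 + i)%N j - w i j
             else - (w M j + \sum_(l < M) w (M.+1 + l)%N j)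
  end.

Lemma column_sequenceK A : MM A -> matrix_of_sequence (column_sequence A) = A.
Proof.
case=> sum0 _ _; apply/matrixP => j k; rewrite mxE.
have alphaE (i : 'I_M.+1) : column_sequence A i j = A j (lshift M.+1 i).
  by rewrite /column_sequence -ltnS ltn_ord inord_val mxE.
have gammaE (i : 'I_M) : column_sequence A (M.+1 + i) j =
    A j (lshift M.+1 (widen_ord (leqnSn M) i)) +
    A j (rshift M.+1 (widen_ord (leqnSn M) i)).
  rewrite /column_sequence ifF; last by apply/negP; lia.
  rewrite addKn !mxE; have -> // : inord i = widen_ord (leqnSn M) i.
  by apply: val_inj; rewrite /= inordK // ltnW // ltnS.
rewrite -[in RHS](fintype.splitK k); case: (fintype.split k) => i //=.
case: ifPn => iM.
  have -> : i = widen_ord (leqnSn M) (Ordinal iM) by apply: val_inj.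
  rewrite (gammaE (Ordinal iM)) (alphaE (widen_ord (leqnSn M) (Ordinal iM))).
  by rewrite addrAC subrr add0r.
have -> : i = ord_max by apply: val_inj => /=; have := ltn_ord i; lia.
rewrite (alphaE ord_max) (eq_bigr _ (fun l _ => gammaE l)) big_split /=.
have := congr1 (fun C : 'cV[K]_m => C j 0) sum0.
rewrite !mxE !summxE !big_ord_recr /= !mxE.
under eq_bigr do rewrite mxE.
under [X in _ + (X + _) = _ -> _]eq_bigr do rewrite mxE.
move: (\sum_(l < M) _) (\sum_(l < M) _) (A j _) (A j _) => sa sb a b sab.
by apply/eqP; rewrite eq_sym -addr_eq0 -sab; apply/eqP; ring.
Qed.

Lemma matrix_of_sequence_poly d (f : ('I_d -> K) -> nat -> 'I_m -> K) :
  (forall i j, poly_fun (fun y => f y i j)) ->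
  poly_map (fun y => entries (matrix_of_sequence (f y))).
Proof.
move=> pf; apply: poly_funP => k; case/mxvec_indexP: k => j k.
rewrite (_ : (fun y => _) = (fun y => match fintype.split k with
    | inl i => f y i j
    | inr i => if (i < M)%N then f y (M.+1 + i)%N j - f y i j
               else - (f y M j + \sum_(l < M) f y (M.+1 + l)%N j)
    end)); last by apply/funext => y; rewrite /entries mxvecE mxE.
case: (fintype.split k) => i; first exact: pf.
case: (i < M)%N.
  by apply: poly_funD; [|apply: poly_funN]; exact: pf.
apply/poly_funN/poly_funD; first exact: pf.
by apply: poly_fun_sum => l; exact: pf.
Qed.

(** The variety is covered by finitely many polynomial images, one for each choice [o] of a
    dependent term in every window. *)
Lemma MM_chain_le l : has_irreducible_chain (set_type (@MM K m M)) l ->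
  (l <= m * M.*2.+1 - M.+2)%N.
Proof.
have /choice[f fP] := windowed_parametrized.
apply: (affine_chain_le (@subtype_closedE _ _) (@subtype_closed _ _)
         (f := fun o y => entries (matrix_of_sequence (f o y)))) => [o|a].
  exact: matrix_of_sequence_poly (fP o).1.
have Aa : MM (set_val a) := set_valP a.
have /choice[o oP] := fun i => window_combination i Aa.
have [|y fy] := (fP (finfun o)).2 (column_sequence (set_val a)).
  by move=> i; rewrite ffunE.
exists (finfun o), y.
transitivity (entries (matrix_of_sequence (column_sequence (set_val a)))).
  by rewrite column_sequenceK.
congr entries.
have lt_a (i : 'I_M.+1) : (i < M.*2.+1)%N by have := ltn_ord i; lia.
apply/matrixP => j k; rewrite !mxE; case: (fintype.split k) => i.
  by rewrite fy // lt_a.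
have lt_g n : (n < M)%N -> (M.+1 + n < M.*2.+1)%N by lia.
rewrite (fy i) ?lt_a // (fy M) ?(lt_a ord_max) //.
case: ifPn => iM; first by rewrite fy ?lt_g.
by congr (- (_ + _)); apply: eq_bigr => n _; rewrite fy ?lt_g.
Qed.

Lemma MM_codim : exists2 k, codim_is (@MM K m M) k & (m + M.+2 <= k)%N.
Proof.
have MM0 : MM (0 : zmatrix K m (M.+1 + M.+1)).
  have alpha0 i : alpha (0 : zmatrix K m (M.+1 + M.+1)) i = 0.
    by apply/matrixP => ? ?; rewrite !mxE.
  have beta0 i : beta (0 : zmatrix K m (M.+1 + M.+1)) i = 0.
    by apply/matrixP => ? ?; rewrite !mxE.
  have rank0 (u : 'I_M.+1 -> 'cV[K]_m) : (forall j, u j = 0) -> (col_rank u <= M - 1)%N.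
    move=> u0; rewrite /col_rank (_ : \matrix_(_, _) _ = 0) ?mxrank0 //.
    by apply/matrixP => i j; rewrite !mxE u0 mxE.
  split=> [|nu|tau rho _]; first by rewrite !big1 ?addr0.
    apply: rank0 => j; rewrite /family_b alpha0 !alpha0 big1 ?addr0 //.
    by case: ifP.
  apply: rank0 => j; rewrite /family_c !alpha0 beta0 big1 ?addr0 //.
  by case: ifP => // _; case: ifP.
have [|d dle dimd] := krull_dim_le _ MM_chain_le.
  (* A single point, here the zero matrix, gives a chain of length 0, so that the dimension
     exists. *)
  pose p : set_type (@MM K m M) := SigSub (mem_set MM0).
  exists (fun=> [set p]); split=> // i _; split; last first.
    split; first by exists p.
    move=> A B _ _ pAB; have [pA|pB] := pAB p erefl; [left|right]; by move=> _ ->.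
  have -> : [set p] = set_val @^-1` zero_locus [set q | exists i, q = 'X_i].
    apply/seteqP; split=> [_ -> _ [k ->]|a az].
      by rewrite mevalXU /p /= linear0 mxE.
    apply: val_inj; rewrite -[LHS]entriesK -[RHS]entriesK; congr of_entries.
    apply/funext => k; rewrite [RHS]/entries /= linear0 mxE.
    by have := az 'X_k (ex_intro _ k erefl); rewrite mevalXU.
  by apply: subtype_closed; exact: closed_zero_locus.
(* [2m(M + 1) - (m(2M + 1) - (M + 2)) = m + M + 2]. *)
exists (m * (M.+1 + M.+1) - d)%N; last by nia.
exists (m * (M.+1 + M.+1))%N, d; split=> //; first exact: affine_space_dim.
by nia.
Qed.

End MMDimension.

(** * The projectivized tangent bundle *)

Section TangentPairs.
Variables (K : closedFieldType) (N : nat).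
Local Notation mat := (zmatrix K 2 N.+1).
Implicit Types A B : mat.

(** For nonzero [l] and [m] these maps are the changes of representative of a tangent line. *)
Definition tangent_act (l m n : K) A : mat :=
  \matrix_(i, j) if i == 0 then l * A 0 j else m * A 1 j + n * A 0 j.

Lemma tangent_act0E l m n A j : tangent_act l m n A 0 j = l * A 0 j.
Proof. by rewrite mxE. Qed.

Lemma tangent_act1E l m n A j : tangent_act l m n A 1 j = m * A 1 j + n * A 0 j.
Proof. by rewrite mxE. Qed.

Lemma row2P A B : (forall j, A 0 j = B 0 j) -> (forall j, A 1 j = B 1 j) -> A = B.
Proof.
move=> AB0 AB1; apply/matrixP => -[[|[|//]] i2] j.
  by have -> : Ordinal i2 = 0 by exact: val_inj.
by have -> : Ordinal i2 = 1 by exact: val_inj.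
Qed.

Lemma tangent_pairs_minor A :
  tangent_pairs A <-> exists a b, A 0 a != 0 /\ A 1 b * A 0 a - A 1 a * A 0 b != 0.
Proof.
split=> [[/rV0Pn[a] ]|[a [b [Aa Aab]]]].
  rewrite mxE => Aa nA; apply: contrapT => nab; apply: nA.
  exists (A 1 a / A 0 a); apply/rowP => b; rewrite !mxE.
  apply/eqP; rewrite -subr_eq0; apply: contrapT => /negP Ab; apply: nab.
  exists a, b; split=> //; apply: contra_neq Ab => Ab.
  apply: (mulfI Aa); rewrite mulr0 -Ab; field.
  by [].
split; first by apply/rV0Pn; exists a; rewrite mxE.
move=> [nu /rowP E]; have := E a; have := E b; rewrite !mxE => Eb Ea.
by case/eqP: Aab; rewrite Ea Eb; ring.
Qed.

Lemma tangent_pairs_act l m n A : l != 0 -> m != 0 ->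
  tangent_pairs A -> tangent_pairs (tangent_act l m n A).
Proof.
move=> l0 m0 /tangent_pairs_minor[a [b [Aa Aab]]].
apply/tangent_pairs_minor; exists a, b; rewrite !tangent_act0E !tangent_act1E.
split; first by rewrite mulf_neq0.
have -> : (m * A 1 b + n * A 0 b) * (l * A 0 a) - (m * A 1 a + n * A 0 a) * (l * A 0 b)
  = l * m * (A 1 b * A 0 a - A 1 a * A 0 b) by ring.
by rewrite !mulf_neq0.
Qed.

Lemma pi_eqP (P Q : tangent_pair K N) :
  \pi_(PT K N) P = \pi_(PT K N) Q <->
  exists l m n, [/\ l != 0, m != 0 & set_val Q = tangent_act l m n (set_val P)].
Proof.
transitivity (same_tangent_line P Q).
  by split=> [/eqmodP|PQ] //; exact/eqmodP.
split=> [/asboolP[l [m [n [l0 m0 /rowP zE /rowP xE]]]]|[l [m [n [l0 m0 E]]]]].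
  exists l, m, n; split=> //; apply: row2P => j.
    by have := zE j; rewrite !mxE.
  by have := xE j; rewrite !mxE.
apply/asboolP; exists l, m, n; rewrite /pt_z /pt_xi E; split=> //; apply/rowP => j;
  by rewrite !mxE.
Qed.

Lemma tangent_act_poly l m n :
  poly_map (fun x => entries (tangent_act l m n (of_entries x))).
Proof.
have entry i j : poly_fun (fun x => (of_entries x : mat) i j).
  exists 'X_(mxvec_index i j) => x.
  by rewrite mevalXU -[in RHS](of_entriesK x) /entries mxvecE.
apply: poly_funP => k; case/mxvec_indexP: k => i j.
rewrite (_ : (fun x => _) = (fun x => if i == 0 then l * of_entries x 0 j
    else m * of_entries x 1 j + n * of_entries x 0 j)); last first.
  by apply/funext => x; rewrite /entries mxvecE mxE.
case: (i == 0); last apply: poly_funD;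
  by apply: poly_funM; [exact: poly_fun_const|exact: entry].
Qed.

(** The booleans freeze [m = 1] and [n = 0], which yields the intermediate members of a chain from a
    point to the full orbit. *)
Definition orbit A (b1 b2 : bool) : set ('I_(2 * N.+1) -> K) :=
  [set x | exists l m n, [/\ l != 0, m != 0, b1 -> m = 1, b2 -> n = 0
                           & x = entries (tangent_act l m n A)]].

(** The action is linear in [(l, m, n)], so the line joining two points of the orbit stays in it
    wherever the interpolated [l] and [m] are nonzero. *)
Lemma orbit_irreducible A b1 b2 : poly_irreducible (orbit A b1 b2).
Proof.
apply: poly_irreducible_curves => x y [l [m [n [l0 m0 m1 n0 ->]]]].
move=> [l' [m' [n' [l0' m0' m1' n0' ->]]]].
set x0 := entries _; set y0 := entries _.
pose g : {poly K} := (l%:P + (l' - l) *: 'X) * (m%:P + (m' - m) *: 'X).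
have gE t : g.[t] = (l + (l' - l) * t) * (m + (m' - m) * t) by rewrite /g !hornerE.
exists (line x0 y0), g; rewrite curve_line0 curve_line1; split=> //.
  apply/eqP => g0; have := gE 0; rewrite g0 horner0 !mulr0 !addr0 => /esym/eqP.
  by rewrite mulf_eq0 (negPf l0) (negPf m0).
move=> t; rewrite gE mulf_eq0 negb_or => /andP[lt mt].
exists (l + (l' - l) * t), (m + (m' - m) * t), (n + (n' - n) * t); split=> //.
- by move=> b; rewrite m1 ?m1' // subrr mul0r addr0.
- by move=> b; rewrite n0 ?n0' // subrr mul0r addr0.
rewrite curve_line; apply/funext => k; case/mxvec_indexP: k => i j.
by rewrite /x0 /y0 /entries !mxvecE !mxE; case: ifP => _; ring.
Qed.

(** Three applications of [growth_geS] along the partial orbits: a nonzero minor detects [m = 1],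
    then [xi_a] detects [n = 0], then [z_a] detects [l = 1]. *)
Lemma orbit_growth A : tangent_pairs A -> growth_ge (orbit A false false) 3.
Proof.
move=> /tangent_pairs_minor[a [b [Aa Aab]]].
(* A scalar other than 0 and 1 moves a point out of the smaller orbit while remaining invertible. *)
have [c] : exists c : K, ~~ root ('X * ('X - 1)) c.
  by apply/closed_nonrootP; rewrite mulf_neq0 ?polyX_eq0 ?polyXsubC_eq0.
rewrite rootE !hornerE mulf_eq0 negb_or subr_eq0 => /andP[c0 c1].
pose X i j : {mpoly K[2 * N.+1]} := 'X_(mxvec_index i j).
have XE i j B : (X i j).@[entries B] = B i j by rewrite mevalXU /entries mxvecE.
have one0 : (1 : K) != 0 by exact: oner_neq0.
apply: (growth_geS (X := orbit A true false)
  (f := X 1 b * (A 0 a)%:MP - X 1 a * (A 0 b)%:MP - (A 1 b * A 0 a - A 1 a * A 0 b)%:MP)).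
- by move=> x [l [m [n [? ? ? ? ->]]]]; exists l, m, n.
- exact: orbit_irreducible.
- move=> x [l [m [n [_ _ m1 _ ->]]]].
  rewrite !(mevalB, mevalM, mevalC, XE) !tangent_act1E m1 //; ring.
- move=> /(_ (entries (tangent_act 1 c 0 A))) H.
  have /eqP : (c - 1) * (A 1 b * A 0 a - A 1 a * A 0 b) = 0.
    rewrite -[RHS]H; last by exists 1, c, 0.
    by rewrite !(mevalB, mevalM, mevalC, XE) !tangent_act1E; ring.
  by rewrite mulf_eq0 (negPf Aab) subr_eq0 (negPf c1).
apply: (growth_geS (X := orbit A true true) (f := X 1 a - (A 1 a)%:MP)).
- by move=> x [l [m [n [? ? m1 ? ->]]]]; exists l, m, n.
- exact: orbit_irreducible.
- move=> x [l [m [n [_ _ m1 n0 ->]]]].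
  rewrite !(mevalB, mevalC, XE) tangent_act1E m1 // n0 //; ring.
- move=> /(_ (entries (tangent_act 1 1 1 A))) H.
  have /eqP : A 0 a = 0.
    rewrite -[RHS]H; last by exists 1, 1, 1.
    by rewrite !(mevalB, mevalC, XE) tangent_act1E; ring.
  by rewrite (negPf Aa).
apply: (growth_geS (X := [set entries A]) (f := X 0 a - (A 0 a)%:MP)).
- move=> _ ->; exists 1, 1, 0; split=> //; congr entries.
  by apply: row2P => j; rewrite ?tangent_act0E ?tangent_act1E; ring.
- exact: orbit_irreducible.
- by move=> _ ->; rewrite mevalB mevalC XE subrr.
- move=> /(_ (entries (tangent_act c 1 0 A))) H.
  have /eqP : (c - 1) * A 0 a = 0.
    rewrite -[RHS]H; last by exists c, 1, 0.
    by rewrite !(mevalB, mevalC, XE) tangent_act0E; ring.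
  by rewrite mulf_eq0 (negPf Aa) subr_eq0 (negPf c1).
by apply: growth_ge0; exists (entries A).
Qed.

Variable X : set (PT K N).

Definition pair_represents (x : 'I_(2 * N.+1) -> K) (a : set_type X) :=
  exists P : tangent_pair K N,
    x = entries (set_val P) /\ \pi_(PT K N) P = set_val a.

Lemma pair_representsE (P : tangent_pair K N) (a : set_type X) :
  \pi_(PT K N) P = set_val a ->
  [set x | pair_represents x a] = orbit (set_val P) false false.
Proof.
move=> Pa; apply/seteqP; split=> [x [Q [-> Qa]]|_ [l [m [n [l0 m0 _ _ ->]]]]].
  have [l [m [n [l0 m0 ->]]]] := (pi_eqP P Q).1 (etrans Pa (esym Qa)).
  by exists l, m, n.
have tP := tangent_pairs_act n l0 m0 (set_valP P).
exists (SigSub (mem_set tP)); split=> //; rewrite -Pa; apply/esym/pi_eqP.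
by exists l, m, n.
Qed.

Lemma closed_PTE (B : set (PT K N)) : closed B -> exists S : set {mpoly K[2 * N.+1]},
  forall P, B (\pi_(PT K N) P) <-> zero_locus S (set_val P).
Proof.
move=> /closed_openC oB.
have clB : closed (\pi_(PT K N) @^-1` B : set (tangent_pair K N)).
  by rewrite -openC preimage_setC.
have [C /closed_zariskiE[S ->] BE] := subtype_closedE clB.
exists S => P; have : (\pi_(PT K N) @^-1` B) P <-> (set_val @^-1` zero_locus S) P.
  by rewrite BE.
by [].
Qed.

(** Upstairs the condition says that all polynomials obtained from [p] by composition with a change
    of representative vanish, which defines a closed set. *)
Lemma closed_PT_vanishing (p : {mpoly K[2 * N.+1]}) :
  closed [set b : PT K N | forall P, \pi_(PT K N) P = b -> p.@[entries (set_val P)] = 0].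
Proof.
set B := [set b | _].
suff clB : closed (\pi_(PT K N) @^-1` B : set (tangent_pair K N)).
  by rewrite -openC /open /= /quotient_open -preimage_setC openC.
pose S := [set q : {mpoly K[2 * N.+1]} | exists l m n, [/\ l != 0, m != 0 &
  forall A, q.@[entries A] = p.@[entries (tangent_act l m n A)]]].
suff -> : \pi_(PT K N) @^-1` B = set_val @^-1` zero_locus S :> set (tangent_pair K N).
  by apply: subtype_closed; exact: closed_zero_locus.
apply/seteqP; split=> [P BP q [l [m [n [l0 m0 qE]]]]|P SP Q QP].
  have tP := tangent_pairs_act n l0 m0 (set_valP P).
  have := BP (SigSub (mem_set tP)); rewrite -/(entries _) qE; apply.
  by apply/esym/pi_eqP; exists l, m, n.
have [l [m [n [l0 m0 ->]]]] := (pi_eqP P Q).1 (esym QP).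
have [lq lqE] := @tangent_act_poly l m n.
have qE A : (p \mPo lq).@[entries A] = p.@[entries (tangent_act l m n A)].
  rewrite comp_mpoly_meval; apply: meval_eq => i.
  by rewrite -lqE entriesK.
rewrite -qE; apply: SP; exists l, m, n; split=> // A; exact: qE.
Qed.

Lemma exists_pair (a : set_type X) :
  exists P : tangent_pair K N, \pi_(PT K N) P = set_val a.
Proof. by exists (repr (set_val a)); rewrite reprK. Qed.

Lemma pair_represents_algebraic : closed_algebraic pair_represents.
Proof.
move=> A /subtype_closedE[B /closed_PTE[S SE] ->]; exists S => _ a [P [-> Pa]].
by rewrite /preimage /= -Pa; exact: SE.
Qed.

Lemma pair_represents_chart : zariski_chart pair_represents.
Proof.
split=> [a||p|a].
- by have [P Pa] := exists_pair a; exists (entries (set_val P)), P.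
- exact: pair_represents_algebraic.
- have -> : [set a | forall x, pair_represents x a -> p.@[x] = 0] =
    set_val @^-1` [set b : PT K N |
      forall P, \pi_(PT K N) P = b -> p.@[entries (set_val P)] = 0].
    apply/seteqP; split=> a pa => [P Pa|_ [P [-> Pa]]]; last exact: pa.
    by apply: pa; exists P.
  by apply: subtype_closed; exact: closed_PT_vanishing.
- have [P Pa] := exists_pair a; rewrite (pair_representsE Pa).
  exact: orbit_irreducible.
Qed.

(** The summand 3 is the growth of the fibres, which are full orbits. *)
Lemma PT_chain_le (J : {set 'I_(2 * N.+1)}) l :
  (forall x a, pair_represents x a -> forall i, i \notin J -> x i = 0) ->
  has_irreducible_chain (set_type X) l -> (l + 3 <= #|J|)%N.
Proof.
move=> XJ; apply: (chain_length_le (f := fun _ : unit => @coordinate_embedding K _ J)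
  pair_represents_chart).
- move=> a; have [P Pa] := exists_pair a; rewrite (pair_representsE Pa).
  exact/orbit_growth/set_valP.
- by move=> _; exact: coordinate_embedding_poly.
- by move=> x a /XJ/coordinate_embedding_onto[y ->]; exists tt, y.
Qed.

End TangentPairs.

(** * Dimension of the coordinate strata *)

Section Strata.
Variables (K : closedFieldType) (N eta : nat) (v : 'I_eta -> 'I_N.+1).
Hypotheses (N_gt0 : (0 < N)%N) (le_eta : (eta <= N)%N) (v_inj : injective v).
Local Notation mat := (zmatrix K 2 N.+1).
Local Notation X := (@PT_stratum K N eta v).

Definition in_stratum (A : mat) :=
  (forall i, A 0 (v i) = 0) /\ (forall j, (forall i, j <> v i) -> A 0 j <> 0).

Lemma in_stratumP (P : tangent_pair K N) :
  X (\pi_(PT K N) P) <-> in_stratum (set_val P).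
Proof.
have [l [m [n [l0 _ PE]]]] := (pi_eqP (repr (\pi_(PT K N) P)) P).1 (reprK _).
have E j : set_val P 0 j = l * hcoord (\pi_(PT K N) P) j.
  by rewrite PE tangent_act0E /hcoord /pt_z mxE.
have E0 j : set_val P 0 j = 0 <-> hcoord (\pi_(PT K N) P) j = 0.
  rewrite E; split=> [/eqP|->]; last by rewrite mulr0.
  by rewrite mulf_eq0 (negPf l0) => /eqP.
split=> -[P0 P1]; split=> [i|j jv].
- exact/E0.
- by move=> /E0; apply: P1.
- exact/E0.
- by move=> /E0; apply: P1.
Qed.

Lemma stratum_chain_le l : has_irreducible_chain (set_type X) l ->
  (l <= 2 * N - eta - 1)%N.
Proof.
pose idx (k : 'I_2 * 'I_N.+1) := mxvec_index k.1 k.2.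
have idx_inj : injective idx.
  by move=> [i j] [i' j'] /cast_ord_inj/enum_rank_inj.
pose Z := [set idx (0, v i) | i : 'I_eta]%SET.
have cardZ : #|Z| = eta.
  by rewrite card_imset ?card_ord // => i i' /idx_inj[/v_inj].
have -> : (2 * N - eta - 1 = 2 * N.+1 - eta - 3)%N by lia.
move=> chain; rewrite leq_subRL; last by lia.
have cardCZ : #|(~: Z)%SET| = (2 * N.+1 - eta)%N.
  by rewrite cardsCs finset.setCK card_ord cardZ.
rewrite addnC -cardCZ.
apply: PT_chain_le chain => x a [P [-> Pa]] i.
rewrite inE negbK => /imsetP[k _ ->]; rewrite /entries mxvecE.
have [Pv _] : in_stratum (set_val P) by apply/in_stratumP; rewrite Pa; exact: set_valP.
exact: Pv.
Qed.

Section Chain.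
Variables j0 j1 : 'I_N.+1.
Hypotheses (j0v : forall i, j0 <> v i) (j10 : j1 != j0).

(** The coordinates left on the stratum once a pair is normalized by [z_(j0) = 1] and [xi_(j0) = 0].
    The coordinate [xi_(j1)] is left out as well: no equation bears on it, so [xi] can be nonzero
    even in the smallest member. *)
Definition chain_indices : {set 'I_2 * 'I_N.+1} :=
  ~: ([set (0, v i) | i : 'I_eta] :|: ((0, j0) |: [set (1, j0); (1, j1)]))%SET.

Lemma card_chain_indices : #|chain_indices| = (2 * N - eta - 1)%N.
Proof.
have cv : #|[set (0 : 'I_2, v i) | i : 'I_eta]%SET| = eta.
  by rewrite card_imset ?card_ord // => i i' [/v_inj].
rewrite /chain_indices cardsCs finset.setCK cardsU cv card_prod !card_ord.
rewrite (_ : _ :&: _ = finset.set0)%SET; last first.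
  apply/setP => k; rewrite !inE; apply/negP => /andP[/imsetP[i _ ->]].
  by rewrite !xpair_eqE /= !orbF => /eqP vj; case: (j0v (esym vj)).
by rewrite cards0 !cardsU1 cards1 !inE !xpair_eqE /= eq_sym (negPf j10) /=; lia.
Qed.

(* Both kinds of equations are preserved, up to a nonzero factor, by the change
   of representative of a tangent line. *)
Definition chain_equation (k : 'I_2 * 'I_N.+1) (A : mat) : K :=
  if k.1 == 0 then A 0 k.2 - A 0 j0 else A 1 k.2 * A 0 j0 - A 1 j0 * A 0 k.2.

Lemma chain_equation_act k l m n A : chain_equation k A = 0 ->
  chain_equation k (tangent_act l m n A) = 0.
Proof.
rewrite /chain_equation !tangent_act0E !tangent_act1E; case: ifP => _ E.
  by rewrite -mulrBr E mulr0.
transitivity (l * m * (A 1 k.2 * A 0 j0 - A 1 j0 * A 0 k.2)); first by ring.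
by rewrite E mulr0.
Qed.

Lemma chain_equation_poly k : exists p : {mpoly K[2 * N.+1]},
  forall A, p.@[entries A] = chain_equation k A.
Proof.
pose Y i j : {mpoly K[2 * N.+1]} := 'X_(mxvec_index i j).
have YE i j A : (Y i j).@[entries A] = A i j by rewrite mevalXU /entries mxvecE.
rewrite /chain_equation; case: (k.1 == 0).
  by exists (Y 0 k.2 - Y 0 j0) => A; rewrite mevalB !YE.
by exists (Y 1 k.2 * Y 0 j0 - Y 1 j0 * Y 0 k.2) => A; rewrite mevalB !mevalM !YE.
Qed.

(** Members grow with [i], as fewer equations are imposed. Coordinates of [z] are equated with
    [z_(j0)] because they may not vanish on the stratum. *)
Definition chain_member (i : nat) : set (set_type X) :=
  [set a | forall k, k \in chain_indices -> (i <= index k (enum chain_indices))%N ->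
    forall P : tangent_pair K N, \pi_(PT K N) P = set_val a ->
    chain_equation k (set_val P) = 0].

Lemma chain_memberE i (a : set_type X) (P : tangent_pair K N) :
  \pi_(PT K N) P = set_val a ->
  chain_member i a <-> forall k, k \in chain_indices ->
    (i <= index k (enum chain_indices))%N -> chain_equation k (set_val P) = 0.
Proof.
move=> Pa; split=> [ai k kI ik|Pi k kI ik Q Qa]; first exact: ai.
have [l [m [n [_ _ ->]]]] := (pi_eqP P Q).1 (etrans Pa (esym Qa)).
exact/chain_equation_act/Pi.
Qed.

Lemma chain_member_closed i : closed (chain_member i).
Proof.
have [_ _ closedR _] := pair_represents_chart X.
pose D := [set k | (k \in chain_indices) && (i <= index k (enum chain_indices))%N].
have /choice[p pE] := chain_equation_poly.
rewrite (_ : chain_member i = \bigcap_(k in D)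
    [set a | forall x, pair_represents x a -> (p k).@[x] = 0]).
  by apply: closed_bigI => k _; exact: closedR.
apply/seteqP; split=> [a ai k /andP[kI ik] _ [P [-> Pa]]|a aD k kI ik P Pa].
  by rewrite pE; exact: ai Pa.
rewrite -pE; apply: (aD k); last by exists P.
by rewrite /D /= kI ik.
Qed.

Lemma normalized_representative (a : set_type X) :
  exists P : tangent_pair K N, [/\ \pi_(PT K N) P = set_val a,
    in_stratum (set_val P), set_val P 0 j0 = 1 & set_val P 1 j0 = 0].
Proof.
have [Q Qa] := exists_pair a.
have QX (P : tangent_pair K N) : \pi_(PT K N) P = set_val a -> in_stratum (set_val P).
  by move=> Pa; apply/in_stratumP; rewrite Pa; exact: set_valP.
have /eqP z0 := (QX Q Qa).2 j0 j0v.
pose l := (set_val Q 0 j0)^-1; pose n := - set_val Q 1 j0 * l.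
have l0 : l != 0 by rewrite invr_eq0.
have tP := tangent_pairs_act n l0 (oner_neq0 _) (set_valP Q).
pose P : tangent_pair K N := SigSub (mem_set tP).
have Pa : \pi_(PT K N) P = set_val a.
  rewrite -Qa; apply/esym/pi_eqP; exists l, 1, n; split=> //; exact: oner_neq0.
exists P; split=> //; first exact: QX.
  by rewrite tangent_act0E mulVf.
by rewrite tangent_act1E mul1r /n /l -mulrA mulVf // mulr1 subrr.
Qed.

Lemma normalized_tangent (A : mat) k : A 0 j0 = 1 -> A 1 j0 = 0 -> A 1 k != 0 ->
  tangent_pairs A.
Proof.
move=> A0 A1 Ak; apply/tangent_pairs_minor; exists j0, k.
by rewrite A0 A1 oner_neq0 mulr1 mul0r subr0.
Qed.

(** The segment between two normalized pairs stays normalized, and on normalized pairs the chain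
    equations are affine, so they persist along it. *)
Lemma chain_member_irreducible i : chain_member i !=set0 ->
  irreducible_set (chain_member i).
Proof.
move=> Zi0.
apply: (irreducible_set_curves (@pair_represents_algebraic _ _ X)) => // a b ai bi.
have [P [Pa PX P0 P1]] := normalized_representative a.
have [Q [Qb QX Q0 Q1]] := normalized_representative b.
pose c := line (entries (set_val P)) (entries (set_val Q)).
pose C t : mat := of_entries (curve c t).
have CE t i1 j : C t i1 j = set_val P i1 j + (set_val Q i1 j - set_val P i1 j) * t.
  have -> : C t i1 j = entries (C t) (mxvec_index i1 j) by rewrite /entries mxvecE.
  by rewrite of_entriesK curve_line /entries !mxvecE.
(* As long as this coordinate of [xi] is nonzero, the normalized pair on the segment is a tangent
   pair. *)
have [kk Pkk] : exists kk, set_val P 1 kk != 0.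
  have /tangent_pairs_minor[a' [b' [_ ab]]] := set_valP P.
  have [Pb|] := eqVneq (set_val P 1 b') 0; last by exists b'.
  exists a'; apply: contra_neq ab => Pa'; first by rewrite Pb Pa' !mul0r subrr.
(* The second factor excludes the [t] at which a coordinate of [z] outside [v] vanishes. *)
pose g := c (mxvec_index 1 kk) *
  \prod_(j | [forall i, j != v i]) c (mxvec_index 0 j).
have cE i1 j t : (c (mxvec_index i1 j)).[t] = C t i1 j.
  by rewrite CE /c /line !hornerE /entries !mxvecE.
have gE t : g.[t] = C t 1 kk * \prod_(j | [forall i, j != v i]) C t 0 j.
  by rewrite hornerM cE horner_prod; congr (_ * _); apply: eq_bigr => j _; rewrite cE.
exists c, g; split.
- by exists P; rewrite curve_line0.
- by exists Q; rewrite curve_line1.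
- have : g.[0] != 0.
    rewrite gE mulf_neq0 ?CE ?mulr0 ?addr0 //; apply/prodf_neq0 => j /forallP jv.
    by rewrite CE mulr0 addr0; apply/eqP/PX.2 => i'; apply/eqP.
  by apply: contra_neq => ->; rewrite horner0.
move=> t; rewrite gE mulf_eq0 negb_or => /andP[Ckk /prodf_neq0 Cj].
have C0 : C t 0 j0 = 1 by rewrite CE P0 Q0 subrr mul0r addr0.
have C1 : C t 1 j0 = 0 by rewrite CE P1 Q1 subrr mul0r addr0.
pose PC : tangent_pair K N := SigSub (mem_set (normalized_tangent C0 C1 Ckk)).
have PCX : X (\pi_(PT K N) PC).
  apply/in_stratumP; split=> [i'|j jv] /=.
    by rewrite CE PX.1 QX.1 subrr mul0r addr0.
  by apply/eqP/Cj/forallP => i'; apply/eqP.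
exists (SigSub (mem_set PCX)); last by exists PC; rewrite /= of_entriesK.
apply/(@chain_memberE _ _ PC) => // k kI ik /=.
have := (chain_memberE i Pa).1 ai k kI ik; have := (chain_memberE i Qb).1 bi k kI ik.
rewrite /chain_equation C0 C1 P0 P1 Q0 Q1 !CE; case: ifP => _ Qk Pk.
  transitivity ((1 - t) * (set_val P 0 k.2 - 1) + t * (set_val Q 0 k.2 - 1)).
    by ring.
  by rewrite Pk Qk !mulr0 addr0.
transitivity ((1 - t) * (set_val P 1 k.2 * 1 - 0 * set_val P 0 k.2)
  + t * (set_val Q 1 k.2 * 1 - 0 * set_val Q 0 k.2)); first by ring.
by rewrite Pk Qk !mulr0 addr0.
Qed.

(** Start from [z] with entries 0 and 1 and [xi] the basis vector of [j1], then change entry [k0]: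
    in [xi] to 1, in [z] to some [c] other than 0 and 1, which stays nonzero yet differs from
    [z_(j0) = 1]. *)
Lemma chain_point (k0 : 'I_2 * 'I_N.+1) : k0.2 != j0 ->
  exists (a : set_type X) (P : tangent_pair K N), \pi_(PT K N) P = set_val a /\
    forall k, k \in chain_indices -> chain_equation k (set_val P) = 0 <-> k != k0.
Proof.
move=> k0j0; have [c] : exists c : K, ~~ root ('X * ('X - 1)) c.
  by apply/closed_nonrootP; rewrite mulf_neq0 ?polyX_eq0 ?polyXsubC_eq0.
rewrite rootE !hornerE mulf_eq0 negb_or subr_eq0 => /andP[c0 c1].
pose A : mat := \matrix_(i, j)
  if i == 0 then if [exists i', j == v i'] then 0 else if k0 == (0, j) then c else 1
  else ((j == j1) || (k0 == (1, j)))%:R.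
have Av j : (forall i, j <> v i) -> A 0 j = if k0 == (0, j) then c else 1.
  by move=> jv; rewrite mxE /= ifF //; apply/existsP => -[i /eqP]; exact: jv.
have A0 : A 0 j0 = 1.
  by rewrite Av // ifF //; apply: contra_neqF k0j0 => /eqP->.
have A1 : A 1 j0 = 0.
  rewrite mxE /= eq_sym (negPf j10) /=; case: eqP => // k0E.
  by rewrite k0E eqxx in k0j0.
have A1j1 : A 1 j1 != 0 by rewrite mxE /= eqxx oner_neq0.
pose P : tangent_pair K N := SigSub (mem_set (normalized_tangent A0 A1 A1j1)).
have PX : X (\pi_(PT K N) P).
  apply/in_stratumP; split=> [i|j jv] /=.
    by rewrite mxE /= ifT //; apply/existsP; exists i.
  by rewrite Av //; apply/eqP; case: ifP => _ //; exact: oner_neq0.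
exists (SigSub (mem_set PX)), P; split=> //= -[i j].
rewrite !inE !xpair_eqE !negb_or => /andP[/imsetP kv].
rewrite /chain_equation /= A0 A1 mulr1 mul0r subr0.
case: i kv => -[|[|//]] i2 kv; [have E : Ordinal i2 = 0 by exact: val_inj|
  have E : Ordinal i2 = 1 by exact: val_inj]; rewrite E /= ?orbF ?andbT => jj.
  rewrite Av => [|i ji]; last by apply: kv; exists i; rewrite // E ji.
  rewrite eq_sym; case: eqP => _; last by rewrite subrr.
  by split=> // /eqP; rewrite subr_eq0 (negPf c1).
rewrite mxE /= [in X in _ <-> X]eq_sym; case/andP: jj => _ /negPf->.
case: eqP => _ //=; split=> // /eqP; by rewrite oner_eq0.
Qed.

Lemma stratum_chain : has_irreducible_chain (set_type X) #|chain_indices|.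
Proof.
exists chain_member; split=> [i _|i iI].
  split; first exact: chain_member_closed.
  apply: chain_member_irreducible.
  (* [(1, j1)] is not a chain index, so this point satisfies all the equations and lies in every
     member. *)
  have [|a [P [Pa PI]]] := @chain_point (1, j1); first by [].
  exists a; apply/(chain_memberE i Pa) => k kI _; apply/(PI k kI).
  by apply: contraTneq kI => ->; rewrite !inE eqxx !orbT.
split=> [a ai k kI /ltnW ik P Pa|]; first exact: ai.
have sI : (i < size (enum chain_indices))%N by rewrite -cardE.
(* The equation of [k0] is imposed on member [i] but no longer on member [i + 1]. *)
pose k0 := nth (0, j0) (enum chain_indices) i.
have k0I : k0 \in chain_indices by rewrite -mem_enum mem_nth.
have k0i : index k0 (enum chain_indices) = i by rewrite index_uniq ?enum_uniq.
have [|a [P [Pa PI]]] := @chain_point k0.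
  apply: contraTneq k0I; case: (k0) => -[[|[|//]] i2] j /= ->.
    have -> : Ordinal i2 = 0 by exact: val_inj.
    by rewrite !inE eqxx !orbT.
  have -> : Ordinal i2 = 1 by exact: val_inj.
  by rewrite !inE !xpair_eqE !eqxx !orbT.
move=> /(_ a) sub; have /sub/(chain_memberE i Pa) H : chain_member i.+1 a.
  apply/(chain_memberE i.+1 Pa) => k kI ik; apply/(PI k kI).
  by apply: contraTneq ik => ->; rewrite k0i ltnn.
by have /(PI k0 k0I) := H k0 k0I (eq_leq (esym k0i)); rewrite eqxx.
Qed.

End Chain.

Lemma stratum_dim : dim_is X (2 * N - eta - 1).
Proof.
split; last exact: stratum_chain_le.
have /card_gt0P[j0] : (0 < #|(~: [set v i | i : 'I_eta])%SET|)%N.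
  by rewrite cardsCs finset.setCK card_imset // !card_ord; lia.
rewrite inE => /imsetP nj0.
have j0v i : j0 <> v i by move=> E; apply: nj0; exists i.
have /card_gt0P[j1] : (0 < #|(~: [set j0])%SET|)%N.
  by rewrite cardsCs finset.setCK cards1 card_ord; lia.
rewrite !inE => j10; rewrite -(card_chain_indices j0v j10).
exact: stratum_chain.
Qed.

End Strata.

(** * The codimension estimates *)

Lemma PT_open_stratum (K : closedFieldType) (N : nat) (v : 'I_0 -> 'I_N.+1) :
  @PT_open K N = PT_stratum (K := K) v.
Proof.
apply/seteqP; split=> p.
  move=> /prodf_neq0 p0; split=> [[]//|j _].
  exact/eqP/p0.
move=> [_ p0]; apply/prodf_neq0 => j _.
by apply/eqP/p0 => -[].
Qed.

Theorem lemma9p5 (K : closedFieldType) (N c r : nat)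
    (hN : (1 <= N)%N) (hcr : (N <= 2 * c + r)%N) :
  (exists k d : nat,
     [/\ codim_is (@MM K (2 * c + r) N) k,
         dim_is (@PT_open K N) d,
         d = (2 * N - 1)%N
       & (d <= k)%N])
  /\
  (forall (eta : nat) (v : 'I_eta -> 'I_N.+1),
     (1 <= eta)%N -> (eta <= N - (c + r) - 1)%N ->
     (forall i j : 'I_eta, (i < j)%N -> (v i < v j)%N) ->
     exists k d : nat,
       [/\ codim_is (@MM K (2 * c + r) (N - eta)) k,
           dim_is (PT_stratum (K := K) v) d,
           d = (2 * N - eta - 1)%N
         & (d <= k)%N]).
Proof.
split=> [|eta v eta_gt0 le_eta v_mono].
  have [k MMk lek] := MM_codim K hN hcr.
  exists k, (2 * N - 1)%N; split=> //; last by lia.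
  (* The open part is the stratum with [eta = 0]. *)
  pose v (i : 'I_0) : 'I_N.+1 := ord0.
  rewrite (PT_open_stratum K v).
  have v_inj : injective v by case.
  have -> : (2 * N - 1 = 2 * N - 0 - 1)%N by lia.
  exact: (stratum_dim K hN (leq0n N) v_inj).
(* The bound on [eta] gives [N - eta >= c + r + 1 > 0]. As [2c + r >= N], the codimension is at
   least [2N - eta + 2]. *)
have [k MMk lek] := @MM_codim K (2 * c + r) (N - eta) ltac:(lia) ltac:(lia).
exists k, (2 * N - eta - 1)%N; split=> //; last by lia.
apply: stratum_dim => //; first by lia.
move=> i j vij; case: (ltngtP i j) => [/v_mono|/v_mono|/ord_inj //].
  by rewrite vij ltnn.
by rewrite vij ltnn.
Qed.
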